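(* Let $d\ge 2$. Every ($d$-dimensional) simplex in $\mathbb{R}^d$ that contains the origin in its interior or has the origin as a vertex is realizable. The same is true for every ($d$-dimensional) parallelepiped in $\mathbb{R}^d$ that contains the origin in its interior or has the origin as a vertex.
   Context: A linear switching system in $\mathbb{R}^d$ is identified with its control set $\mathcal{A}$, a nonempty compact set of real $d\times d$ matrices. A trajectory is an absolutely continuous function $x:[0,\infty)\to\mathbb{R}^d$ such that $\dot x(t)=A(t)x(t)$ for almost every $t$, for some measurable function $A(\cdot):[0,\infty)\to\mathcal{A}$. The Lyapunov exponent $\sigma(\mathcal{A})$ is the infimum of all $\beta\in\mathbb{R}$ such that every trajectory satisfies $\|x(t)\|\le C e^{\beta t}$ for all $t\ge0$ with a constant $C$ depending on the trajectory. Standing assumption: $\mathcal{A}$ is convex and the corresponding normalized system $\mathcal{A}-\sigma(\mathcal{A})I=\{A-\sigma(\mathcal A)I: A\in\mathcal{A}\}$ does not contain the zero matrix, i.e. $\sigma(\mathcal{A})I\notin\mathcal{A}$. For a compact set $M\subset\mathbb{R}^d$ and $t\ge 0$, $M_t$ denotes the set of points $x(t)$ over all trajectories with $x(0)\in M$. An eigenset of $\mathcal{A}$ is a compact set $M\ne\emptyset$, $M\neq\{0\}$, for which there is $\alpha\in\mathbb{R}$ with $M_t=e^{\alpha t}M$ for all $t\ge0$. The system is irreducible if the matrices of $\mathcal{A}$ have no common invariant linear subspace other than $\{0\}$ and $\mathbb{R}^d$. A compact set $M\subset\mathbb{R}^d$ is realizable if there exists an irreducible linear switching system $\mathcal{A}$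 for which $M$ is an eigenset. *)

(* Defs.v *)
From HB Require Import structures.
From mathcomp Require Import all_boot all_order all_algebra.
From mathcomp Require Import all_classical all_reals all_analysis.
From mathcomp Require Import measurable_realfun.

Set Implicit Arguments.
Unset Strict Implicit.
Unset Printing Implicit Defensive.

Import Order.TTheory GRing.Theory Num.Theory.
Import numFieldNormedType.Exports.

Local Open Scope classical_set_scope.
Local Open Scope ring_scope.

(* Lebesgue measurability: the domain carries the completion of the Borel
   sigma-algebra with respect to the Lebesgue measure. *)
Definition lebesgue_measurable_fun (R : realType) (D : set R) (f : R -> R) :=
  @measurable_fun _ _
    (g_sigma_algebraType (completed_algebra_gen (@lebesgue_measure R)))
    (measurableTypeR R) D f.

Definition abs_continuous_on (R : realType) (W : normedModType R)
    (a b : R) (x : R -> W) :=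
  forall e : R, 0 < e -> exists2 delta : R, 0 < delta &
    forall (n : nat) (u v : 'I_n -> R),
      (forall i, a <= u i /\ u i <= v i /\ v i <= b) ->
      trivIset [set: 'I_n] (fun i => `]u i, v i[%classic) ->
      \sum_i (v i - u i) < delta ->
      \sum_i `|x (v i) - x (u i)| < e.

(* A trajectory on [0, +oo[ is represented by a function on the whole line whose
   values at negative times are irrelevant. Absolute continuity on the unbounded
   interval [0, +oo[ is understood locally: requiring it with a single delta for
   the whole half-line would exclude exponentially growing solutions. *)
Definition trajectory (R : realType) (d : nat) (A : set 'M[R]_d)
    (x : R -> 'cV[R]_d) :=
  (forall T : R, 0 <= T -> abs_continuous_on 0 T x) /\
  exists B : R -> 'M[R]_d,
    [/\ (forall i j, lebesgue_measurable_fun `[0, +oo[%classic (fun t => B t i j)),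
        (forall t, 0 <= t -> A (B t)) &
        {ae @lebesgue_measure R, forall t, 0 <= t ->
          is_derive (t : R^o) 1 (x : R^o -> 'cV[R]_d) (B t *m x t)}].

(* For nonempty compact A (and d > 0) the set below is nonempty and bounded
   from below, so that the real-valued inf is a genuine infimum. *)
Definition lyapunov_exponent (R : realType) (d : nat) (A : set 'M[R]_d) : R :=
  inf [set beta : R | forall x, trajectory A x ->
    exists C : R, forall t, 0 <= t -> `|x t| <= C * expR (beta * t)].

(* The last clause says that the normalized system A - sigma(A) I does not
   contain the zero matrix. *)
Definition linear_switching_system (R : realType) (d : nat)
    (A : set 'M[R]_d) :=
  [/\ A !=set0, compact A, convex_set A &
      ~ [set a - (lyapunov_exponent A)%:M | a in A] 0].

Definition irreducible_system (R : realType) (d : nat) (A : set 'M[R]_d) :=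
  forall V : {vspace 'cV[R]_d},
    (forall a, A a -> forall y, y \in V -> a *m y \in V) ->
    V = 0%VS \/ V = fullv.

Definition reach (R : realType) (d : nat) (A : set 'M[R]_d)
    (M : set 'cV[R]_d) (t : R) : set 'cV[R]_d :=
  [set y | exists x, [/\ trajectory A x, M (x 0) & y = x t]].

Definition eigenset (R : realType) (d : nat) (A : set 'M[R]_d)
    (M : set 'cV[R]_d) :=
  [/\ compact M, M !=set0, M <> [set 0] &
      exists alpha : R, forall t, 0 <= t ->
        reach A M t = [set expR (alpha * t) *: y | y in M]].

Definition realizable (R : realType) (d : nat) (M : set 'cV[R]_d) :=
  exists A : set 'M[R]_d,
    [/\ linear_switching_system A, irreducible_system A & eigenset A M].

Definition affinely_independent (R : realType) (d n : nat)
    (v : 'I_n.+1 -> 'cV[R]_d) :=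
  free [tuple v (lift ord0 i) - v ord0 | i < n].

Definition simplex (R : realType) (d n : nat) (v : 'I_n.+1 -> 'cV[R]_d) :
    set 'cV[R]_d :=
  [set \sum_i l i *: v i | l in
    [set l : 'I_n.+1 -> R | (forall i, 0 <= l i) /\ \sum_i l i = 1]].

Definition parallelepiped (R : realType) (d n : nat) (p : 'cV[R]_d)
    (e : 'I_n -> 'cV[R]_d) : set 'cV[R]_d :=
  [set p + \sum_i s i *: e i | s in
    [set s : 'I_n -> R | forall i, 0 <= s i /\ s i <= 1]].

Definition parallelepiped_vertex (R : realType) (d n : nat) (p : 'cV[R]_d)
    (e : 'I_n -> 'cV[R]_d) (I : {set 'I_n}) : 'cV[R]_d :=
  p + \sum_(i in I) e i.

(* Main.v *)
(* Idea: it suffices to find matrices of trace -1 that keep M invariant and let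
   every point of M be reached, in any given time, from a point of M. All such
   dissipative matrices of bounded norm form a compact convex set for which M is
   an eigenset with alpha = 0. It contains no multiple sigma I: some nonzero point
   is stationary, so sigma >= 0, whereas trace -1 forces sigma < 0.

   Invariance: if M is cut out by the slacks g_k >= 0, the sum of the squared
   negative parts of g_k satisfies a Gronwall inequality along trajectories, since
   an absolutely continuous function with a.e. nonpositive derivative does not
   increase.

   Reachability: the rank-one generators A = u phi, phi u = -1, move points along
   straight lines, so the motion can be traced backwards from a given point until
   a point annihilated by some generator is met. For a simplex the generators let
   two barycentric coordinates exchange mass, and a point with two vanishing
   coordinates is stationary. For a parallelepiped a coordinate is attracted by a
   multiple of another one: two coordinates are first pushed to the boundary, and
   then one of them is a fixed point of the attraction by the other. *)
Require Import Defs.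
From HB Require Import structures.
From mathcomp Require Import all_boot all_order all_algebra.
From mathcomp Require Import all_classical all_reals all_analysis.
From mathcomp Require Import measurable_realfun.
From mathcomp Require Import ring lra.

Set Implicit Arguments.
Unset Strict Implicit.
Unset Printing Implicit Defensive.

Import Order.TTheory GRing.Theory Num.Theory.
Import numFieldNormedType.Exports.

Local Open Scope classical_set_scope.
Local Open Scope ring_scope.

(** * Absolutely continuous functions with nonpositive derivative *)

(* [chain U h e s]: disjoint intervals in [U] account for all of the growth of
   [h] on [0, s] in excess of slope [e]. *)
Definition chain (R : realType) (U : set R) (h : R -> R) (e s : R) :=
  exists n (u v : nat -> R),
    [/\ forall i, (i < n)%N -> [/\ 0 <= u i, u i <= v i & v i <= s],
        forall i, (i < n)%N -> `[u i, v i]%classic `<=` U,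
        forall i j, (i < j < n)%N -> v i <= u j &
        h s - h 0 <= e * s + \sum_(i < n) (h (v i) - h (u i))].

Lemma chain0 (R : realType) (U : set R) (h : R -> R) (e : R) : chain U h e 0.
Proof.
exists 0%N, (fun=> 0), (fun=> 0); split => //.
by rewrite big_ord0 subrr mulr0 addr0.
Qed.

Lemma chain_slope (R : realType) (U : set R) (h : R -> R) (e s s' : R) :
  s <= s' -> h s' - h s <= e * (s' - s) -> chain U h e s -> chain U h e s'.
Proof.
move=> ss' hss' [n [u [v [uv uvU dis hs]]]]; exists n, u, v; split => //.
  by move=> i /uv[? ? ?]; split => //; apply: le_trans ss'.
lra.
Qed.

Lemma chain_open (R : realType) (U : set R) (h : R -> R) (e s s' : R) :
  0 <= e -> 0 <= s -> s <= s' -> `[s, s']%classic `<=` U ->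
  chain U h e s -> chain U h e s'.
Proof.
move=> e0 s0 ss' ssU [n [u [v [uv uvU dis hs]]]].
pose ext (w : nat -> R) x i := if (i < n)%N then w i else x.
have extE w x i : (i < n)%N -> ext w x i = w i by rewrite /ext => ->.
have extn w x : ext w x n = x by rewrite /ext ltnn.
exists n.+1, (ext u s), (ext v s'); split.
- move=> i; rewrite ltnS leq_eqVlt => /orP[/eqP ->|lt_in].
    by rewrite !extn; split.
  by rewrite !extE//; have [? ? ?] := uv _ lt_in; split => //; apply: le_trans ss'.
- move=> i; rewrite ltnS leq_eqVlt => /orP[/eqP ->|lt_in].
    by rewrite !extn.
  by rewrite !extE//; exact: uvU.
- move=> i j /andP[ij]; rewrite ltnS leq_eqVlt => /orP[/eqP jn|lt_jn].
    by rewrite jn extn extE -?jn//; have [] := uv i; rewrite -?jn.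
  rewrite !extE//; last exact: ltn_trans lt_jn.
  by apply: dis; rewrite ij.
- rewrite big_ord_recr/= !extn.
  rewrite (eq_bigr (fun i : 'I_n => h (v i) - h (u i))); last first.
    by move=> i _; rewrite !extE.
  have := ler_wpM2l e0 ss'; lra.
Qed.

(** Real induction: let [c] be the supremum of the points of [0, T] that admit a chain. Near [c], a
    chain extends from some [s <= c] to any [s' >= c], by adding an interval inside [U] if [U c] and
    by the slope bound across [c] otherwise. Hence the chain either reaches [T] or passes [c], and
    the latter is absurd. *)
Lemma chain_exists (R : realType) (U : set R) (h : R -> R) (e T : R) :
  0 <= e -> 0 <= T -> open U ->
  (forall t, 0 <= t <= T -> ~ U t ->
    exists2 delta, 0 < delta & forall u v, t - delta < u -> u <= t -> t <= v ->
      v < t + delta -> h v - h u <= e * (v - u)) ->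
  chain U h e T.
Proof.
move=> e0 T0 oU hU.
pose S := [set s | 0 <= s <= T /\ chain U h e s].
have S0 : S 0 by split; [rewrite lexx T0|exact: chain0].
have ubS : ubound S T by move=> s [/andP[]].
pose c := sup S.
have c0 : 0 <= c by apply: ub_le_sup => //; exists T.
have cT : c <= T by apply: ge_sup => //; exists 0.
have [d d0 step] : exists2 d, 0 < d & forall s s', c - d < s -> s <= c ->
    c <= s' -> s' < c + d -> S s -> chain U h e s'.
  have [Uc|nUc] := pselect (U c).
    have /nbhs_ballP[d /= d0 dU] := oU _ Uc.
    exists d => // s s' cs sc cs' s'c [/andP[s0 _] chs].
    apply: chain_open chs => //; first exact: le_trans cs'.
    move=> x; rewrite /= in_itv/= => /andP[sx xs']; apply: dU.
    rewrite /ball/= ltr_norml; apply/andP; split; lra.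
  have c0T : 0 <= c <= T by rewrite c0.
  have [d d0 dP] := hU c c0T nUc.
  exists d => // s s' cs sc cs' s'c [/andP[s0 _] chs].
  by apply: chain_slope chs; [exact: le_trans cs'|exact: dP].
have [s Ss cs] : exists2 s, S s & c - d < s.
  by apply: sup_gt; [exists 0|rewrite ltrBlDr ltrDl].
have sc : s <= c by apply: ub_le_sup => //; exists T.
have [Tcd|cdT] := ltP T (c + d); first exact: (step s T).
have : S (c + d / 2).
  split; first by lra.
  by apply: (step s) => //; lra.
move/(ub_le_sup (ex_intro _ T ubS)); rewrite -/c; lra.
Qed.

(** Division-free form of the derivative: it stays meaningful at [s = t], and estimates on the two
    sides of [t] can be added. *)
Lemma is_derive_eps (R : realType) (W : normedModType R) (x : R -> W)
    (t : R) (l : W) :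
  is_derive (t : R^o) 1 (x : R^o -> W) l <->
  forall e, 0 < e -> exists2 delta : R, 0 < delta & forall s, `|s - t| < delta ->
    `|x s - x t - (s - t) *: l| <= e * `|s - t|.
Proof.
have quot s : s != t ->
    `|l - (s - t)^-1 *: (x s - x t)| = `|s - t|^-1 * `|x s - x t - (s - t) *: l|.
  move=> st; have st0 : s - t != 0 by rewrite subr_eq0.
  rewrite -[in RHS]normfV -normrZ [in RHS]scalerBr scalerA mulVf// scale1r.
  by rewrite distrC.
split=> [[xd xl] e e0|xe].
  have /cvgrPdist_le/(_ e e0)[/= d d0 xd'] :
      h^-1 *: ((x (h *: 1 + t) : W) - x t) @[h --> 0^'] --> l.
    by rewrite -xl; exact: xd.
  exists d => // s std; have [->|st] := eqVneq s t.
    by rewrite !subrr scale0r subrr !normr0 mulr0.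
  have st0 : s - t != 0 by rewrite subr_eq0.
  have := xd' (s - t); rewrite /= sub0r normrN => /(_ std st0).
  rewrite [_ *: 1]mulr1 subrK quot// mulrC ler_pdivrMr ?normr_gt0//.
have xl : h^-1 *: ((x (h *: 1 + t) : W) - x t) @[h --> 0^'] --> l.
  apply/cvgrPdist_le => e e0; have [d d0 xd] := xe e e0.
  exists d => //= h; rewrite /= sub0r normrN => hd h0.
  rewrite [_ *: 1]mulr1; have := quot (h + t).
  rewrite addrK -subr_eq0 addrK => ->//.
  rewrite mulrC ler_pdivrMr ?normr_gt0//.
  by have := xd (h + t); rewrite addrK; exact.
split; first by apply/cvg_ex; exists l.
exact/cvg_lim.
Qed.

Lemma measure_disjoint_itv (R : realType) (U : set R) (n : nat) (u v : 'I_n -> R)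
    (delta : R) :
  open U -> (@lebesgue_measure R U < delta%:E)%E ->
  (forall i, u i <= v i) -> (forall i, `[u i, v i]%classic `<=` U) ->
  trivIset [set: 'I_n] (fun i => `]u i, v i[%classic) ->
  \sum_i (v i - u i) < delta.
Proof.
move=> oU Ud uv uvU dis; rewrite -lte_fin; apply: le_lt_trans Ud.
have -> : (\sum_i (v i - u i))%:E =
    (\sum_i @lebesgue_measure R `]u i, v i[%classic)%E.
  rewrite -sumEFin; apply: eq_bigr => i _.
  rewrite lebesgue_measure_itv/= lte_fin; case: ltP => [_|vu]; first by rewrite EFinB.
  suff -> : v i = u i by rewrite subrr.
  by apply/eqP; rewrite eq_le uv vu.
rewrite -(measure_bigsetU_ord _ xpredT)//.
apply: le_measure; rewrite ?inE.
- by apply: bigsetU_measurable => i _; exact: measurable_itv.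
- exact: open_measurable.
- elim/big_ind: _ => [|A B AU BU|i _]; first exact: sub0set.
  + by rewrite subUset.
  + apply: subset_trans (uvU i) => x; rewrite /= !in_itv/= => /andP[? ?].
    by rewrite !ltW.
Qed.

(** The exceptional null set is enclosed in an open [U] of measure below [delta]. A chain bounds
    [h T - h 0] by [e' * T] plus the growth over disjoint intervals inside [U], and absolute
    continuity keeps that growth below [e']. Altogether this is less than [e' * (T + 1) = e]. *)
Lemma ac_nonincreasing (R : realType) (h : R -> R) (T : R) :
  0 <= T -> abs_continuous_on 0 T (h : R -> R^o) ->
  {ae @lebesgue_measure R, forall t, 0 <= t <= T ->
    exists2 l : R, l <= 0 & is_derive (t : R^o) 1 (h : R^o -> R^o) l} ->
  h T <= h 0.
Proof.
move=> T0 ach [N [mN N0 hN]]; rewrite -subr_le0; apply/ler_addgt0Pr => e e0.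
rewrite add0r.
pose e' := e / (T + 1).
have T1 : 0 < T + 1 by rewrite ltr_wpDl.
have e'0 : 0 < e' by rewrite divr_gt0.
have [delta delta0 hdelta] := ach _ e'0.
have [|//|U [oU NU UN]] := @lebesgue_regularity_outer R N delta mN.
  by rewrite [X in (X < _)%E]N0 ltry.
have {}UN : (@lebesgue_measure R U < delta%:E)%E.
  have -> : @lebesgue_measure R U =
      (@lebesgue_measure R (U `\` N) + @lebesgue_measure R (U `&` N))%E.
    by apply: measureDI => //; exact: open_measurable.
  by rewrite (setIidr NU) [X in (_ + X)%E]N0 adde0.
have [n [u [v [uv uvU dis hT]]]] : chain U h e' T.
  apply: chain_exists => //; first exact: ltW.
  move=> t t0T nUt.
  have [l l0 /is_derive_eps/(_ _ e'0)[d d0 hd]] : exists2 l : R, l <= 0 &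
      is_derive (t : R^o) 1 (h : R^o -> R^o) l.
    apply: contrapT => nd; apply: nUt; apply: NU; apply: hN => /= /(_ t0T).
    exact: nd.
  (* The one-sided estimates on [a, t] and [t, b] add up to slope [e'], since the contributions of
     [l <= 0] have the right sign. *)
  exists d => // a b ta at_ tb bt.
  have := hd b; rewrite [`|b - t|]ger0_norm ?subr_ge0// ltrBlDl => /(_ bt).
  move=> /ler_normlP[_ Hb].
  have := hd a; rewrite [`|a - t|]ler0_norm ?subr_le0// opprB ltrBlDr -ltrBlDl.
  move=> /(_ ta) /ler_normlP[Ha _].
  have lb : (b - t) * l <= 0 by rewrite mulr_ge0_le0// subr_ge0.
  have la : 0 <= (a - t) * l by rewrite mulr_le0// subr_le0.
  rewrite /GRing.scale/= in Ha Hb; lra.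
have sumd : \sum_(i < n) `|h (v i) - h (u i)| < e'.
  have dis' : trivIset [set: 'I_n] (fun i => `]u i, v i[%classic).
    apply/trivIsetP => i j _ _ ij; rewrite -subset0 => x [].
    rewrite /= !in_itv/= => /andP[ui vi] /andP[uj vj].
    have [lt_ij|lt_ji|/val_inj eq_ij] := ltngtP i j.
    - have := dis i j; rewrite lt_ij ltn_ord => /(_ isT); lra.
    - have := dis j i; rewrite lt_ji ltn_ord => /(_ isT); lra.
    - by rewrite eq_ij eqxx in ij.
  apply: (hdelta n (fun i => u i) (fun i => v i)) => //.
    by move=> i; have [] := uv i (ltn_ord i).
  apply: (measure_disjoint_itv oU) => // i; last exact: uvU.
  by have [] := uv i (ltn_ord i).
have : \sum_(i < n) (h (v i) - h (u i)) <= \sum_(i < n) `|h (v i) - h (u i)|.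
  by apply: ler_sum => i _; exact: ler_norm.
have : e' * (T + 1) = e by rewrite divfK// gt_eqF.
lra.
Qed.

(** The term [v - u] in the bound lets factors that are Lipschitz in time be treated together with
    functions of [x]. *)
Lemma abs_continuous_on_control (R : realType) (V W : normedModType R)
    (a b L : R) (x : R -> V) (y : R -> W) :
  0 <= L -> abs_continuous_on a b x ->
  (forall u v, a <= u -> u <= v -> v <= b ->
    `|y v - y u| <= L * ((v - u) + `|x v - x u|)) ->
  abs_continuous_on a b y.
Proof.
move=> L0 xac xy e e0.
(* Half of the tolerance goes to the total length and half to the variation of [x]; [L + 1] also
   covers [L = 0]. *)
pose e' := e / (L + 1) / 2.
have L1 : 0 < L + 1 by rewrite ltr_wpDl.
have e'0 : 0 < e' by rewrite !divr_gt0.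
have [d d0 dx] := xac _ e'0.
exists (Num.min d e'); first by rewrite lt_min d0.
move=> n u v uv dis; rewrite lt_min => /andP[sd se].
have {}sx := dx n u v uv dis sd.
apply: (@le_lt_trans _ _ (L * (\sum_i (v i - u i) + \sum_i `|x (v i) - x (u i)|))).
  rewrite -big_split/= mulr_sumr; apply: ler_sum => i _.
  by have [? [? ?]] := uv i; exact: xy.
have ee : 2 * e' * (L + 1) = e.
  by rewrite /e'; field; rewrite gt_eqF.
rewrite -ee.
have : L * (\sum_i (v i - u i) + \sum_i `|x (v i) - x (u i)|) <= L * (2 * e').
  by apply: ler_wpM2l => //; lra.
lra.
Qed.

(** Increments over steps shorter than the [d] that belongs to the tolerance 1 are below 1, and
    finitely many steps of length [d / 2] cover [0, T]. *)
Lemma abs_continuous_on_bounded (R : realType) (W : normedModType R)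
    (T : R) (x : R -> W) :
  abs_continuous_on 0 T x ->
  exists2 B, 0 <= B & forall t, 0 <= t -> t <= T -> `|x t| <= B.
Proof.
move=> /(_ 1 ltr01)[d d0 xd].
have short u v : 0 <= u -> u <= v -> v <= T -> v - u < d -> `|x v - x u| < 1.
  move=> u0 uv vT vud.
  have := xd 1%N (fun=> u) (fun=> v); rewrite !big_ord1; apply => //.
  by apply/trivIsetP => i j _ _; rewrite !ord1 eqxx.
have steps n t : 0 <= t -> t <= T -> t <= n%:R * (d / 2) -> `|x t| <= `|x 0| + n%:R.
  elim: n t => [|n IH] t t0 tT.
    by rewrite mul0r => t0'; rewrite (_ : t = 0) ?addr0//; apply/eqP; rewrite eq_le t0 t0'.
  rewrite -natr1 mulrDl mul1r => tn.
  have [td|td] := leP t (d / 2).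
    have := short 0 t (lexx _) t0 tT; rewrite subr0 => /(_ ltac:(lra)).
    have := ler_normD (x t - x 0) (x 0); rewrite subrK.
    have : 0 <= n%:R :> R by [].
    lra.
  have := short (t - d / 2) t; rewrite opprB addrCA subrr addr0.
  move=> /(_ ltac:(lra) ltac:(lra) tT ltac:(lra)).
  have := IH (t - d / 2) ltac:(lra) ltac:(lra) ltac:(lra).
  have := ler_normD (x t - x (t - d / 2)) (x (t - d / 2)); rewrite subrK.
  lra.
pose n := Num.bound (T / (d / 2)).
exists (`|x 0| + n%:R); first by rewrite addr_ge0.
move=> t t0 tT; apply: steps => //.
rewrite -ler_pdivrMr ?divr_gt0//.
apply: (@le_trans _ _ (T / (d / 2))); first by rewrite ler_pM2r// invr_gt0 divr_gt0.
by apply/ltW/archi_boundP; rewrite divr_ge0 ?divr_ge0 ?(ltW d0)// (le_trans t0).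
Qed.

(** * Linear forms and negative parts *)

Definition lform (R : realType) (d : nat) (f : 'rV[R]_d) (x : 'cV[R]_d) : R :=
  (f *m x) 0 0.

Lemma lformE (R : realType) (d : nat) (f : 'rV[R]_d) (x : 'cV[R]_d) :
  lform f x = \sum_i f 0 i * x i 0.
Proof. by rewrite /lform mxE. Qed.

Lemma lformD (R : realType) (d : nat) (f : 'rV[R]_d) (x y : 'cV[R]_d) :
  lform f (x + y) = lform f x + lform f y.
Proof. by rewrite /lform mulmxDr mxE. Qed.

Lemma lformN (R : realType) (d : nat) (f : 'rV[R]_d) (x : 'cV[R]_d) :
  lform f (- x) = - lform f x.
Proof. by rewrite /lform mulmxN mxE. Qed.

Lemma lformB (R : realType) (d : nat) (f : 'rV[R]_d) (x y : 'cV[R]_d) :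
  lform f (x - y) = lform f x - lform f y.
Proof. by rewrite lformD lformN. Qed.

Lemma lformZ (R : realType) (d : nat) (f : 'rV[R]_d) (a : R) (x : 'cV[R]_d) :
  lform f (a *: x) = a * lform f x.
Proof. by rewrite /lform -scalemxAr mxE. Qed.

Lemma lform0 (R : realType) (d : nat) (f : 'rV[R]_d) : lform f 0 = 0.
Proof. by rewrite /lform mulmx0 mxE. Qed.

Lemma lform_sum (R : realType) (d : nat) (f : 'rV[R]_d) (I : finType)
    (F : I -> 'cV[R]_d) : lform f (\sum_i F i) = \sum_i lform f (F i).
Proof. by rewrite /lform mulmx_sumr summxE. Qed.

Lemma lformDl (R : realType) (d : nat) (f g : 'rV[R]_d) (x : 'cV[R]_d) :
  lform (f + g) x = lform f x + lform g x.
Proof. by rewrite /lform mulmxDl mxE. Qed.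

Lemma lformNl (R : realType) (d : nat) (f : 'rV[R]_d) (x : 'cV[R]_d) :
  lform (- f) x = - lform f x.
Proof. by rewrite /lform mulNmx mxE. Qed.

Lemma lformZl (R : realType) (d : nat) (a : R) (f : 'rV[R]_d) (x : 'cV[R]_d) :
  lform (a *: f) x = a * lform f x.
Proof. by rewrite /lform -scalemxAl mxE. Qed.

Lemma mul_dyad (R : realType) (d : nat) (u x : 'cV[R]_d) (f : 'rV[R]_d) :
  (u *m f) *m x = lform f x *: u.
Proof. by rewrite -mulmxA [f *m x]mx11_scalar mul_mx_scalar. Qed.

Lemma trace_dyad (R : realType) (d : nat) (u : 'cV[R]_d) (f : 'rV[R]_d) :
  \tr (u *m f) = lform f u.
Proof. by rewrite mxtrace_mulC /mxtrace big_ord1. Qed.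

Lemma ler_entry_norm (R : realType) (m n : nat) (A : 'M[R]_(m, n)) i j :
  `|A i j| <= `|A|.
Proof.
rewrite [leRHS]/Num.Def.normr/= mx_normrE.
exact: (le_bigmax _ (fun ij => `|A ij.1 ij.2|) (i, j)).
Qed.

Lemma lform_norm_le (R : realType) (d : nat) (f : 'rV[R]_d) :
  exists2 K, 0 <= K & forall x, `|lform f x| <= K * `|x|.
Proof.
exists (\sum_i `|f 0 i|) => [|x]; first exact: sumr_ge0.
rewrite lformE; apply: le_trans (ler_norm_sum _ _ _) _.
rewrite mulr_suml; apply: ler_sum => i _.
by rewrite normrM ler_wpM2l// ler_entry_norm.
Qed.

Lemma is_derive_bounded_linear (R : realType) (V W : normedModType R)
    (g : V -> W) (K : R) (x : R -> V) (t : R) (l : V) :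
  0 <= K -> (forall y z, g (y - z) = g y - g z) ->
  (forall a y, g (a *: y) = a *: g y) -> (forall y, `|g y| <= K * `|y|) ->
  is_derive (t : R^o) 1 (x : R^o -> V) l ->
  is_derive (t : R^o) 1 (g \o x : R^o -> W) (g l).
Proof.
move=> K0 gB gZ gK /is_derive_eps xl; apply/is_derive_eps => e e0.
have K1 : 0 < K + 1 by rewrite ltr_wpDl.
have [del del0 xd] := xl (e / (K + 1)) (divr_gt0 e0 K1).
exists del => // s std.
rewrite /= -gZ -!gB.
apply: le_trans (gK _) _; apply: (@le_trans _ _ (K * (e / (K + 1) * `|s - t|))).
  by rewrite ler_wpM2l// xd.
rewrite mulrA ler_wpM2r// mulrA ler_pdivrMr//; nra.
Qed.

Lemma is_derive_lform (R : realType) (d : nat) (f : 'rV[R]_d) (x : R -> 'cV[R]_d)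
    (t : R) (l : 'cV[R]_d) :
  is_derive (t : R^o) 1 (x : R^o -> 'cV[R]_d) l ->
  is_derive (t : R^o) 1 (fun s => lform f (x s) : R^o) (lform f l).
Proof.
have [K K0 fK] := lform_norm_le f.
apply: (@is_derive_bounded_linear _ _ R^o (lform f) K) => // *.
- exact: lformB.
- exact: lformZ.
Qed.

Definition negpart (R : realType) (s : R) : R := Num.max 0 (- s).

Lemma negpart_ge0 (R : realType) (s : R) : 0 <= negpart s.
Proof. by rewrite le_max lexx. Qed.

Lemma negpartNr (R : realType) (s : R) : - s <= negpart s.
Proof. by rewrite le_max lexx orbT. Qed.

Lemma negpart_eq0 (R : realType) (s : R) : (negpart s == 0) = (0 <= s).
Proof.
rewrite /negpart; case: (leP 0 (- s)) => [s0|/ltW s0].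
  by rewrite oppr_eq0 eq_le -oppr_ge0 s0.
by rewrite eqxx -oppr_le0 s0.
Qed.

Lemma negpart_mul (R : realType) (s : R) : negpart s * s = - negpart s ^+ 2.
Proof. by rewrite /negpart; case: (leP 0 (- s)) => s0; rewrite expr2; lra. Qed.

Lemma negpart_lip (R : realType) (s t : R) : `|negpart s - negpart t| <= `|s - t|.
Proof.
have := ler_norm (s - t); have := ler_norm (t - s); rewrite [`|t - s|]distrC.
rewrite /negpart; case: (leP 0 (- s)) => s0; case: (leP 0 (- t)) => t0;
  rewrite ler_norml => ? ?; apply/andP; split; lra.
Qed.

(** Squaring removes the kink of the negative part at 0: the first-order remainder is at most
    [(a - s) ^+ 2] everywhere. *)
Lemma is_derive_negpart_sqr (R : realType) (s : R) :
  is_derive s 1 (fun s => negpart s ^+ 2) (- 2 * negpart s).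
Proof.
have quad a : `|negpart a ^+ 2 - negpart s ^+ 2 - (a - s) * (- 2 * negpart s)|
    <= `|a - s| ^+ 2.
  rewrite real_normK ?num_real//.
  have := sqr_ge0 (a - s); have := sqr_ge0 s; have := sqr_ge0 a.
  rewrite /negpart; case: (leP 0 (- s)) => s0; case: (leP 0 (- a)) => a0.
  - by rewrite ler_norml => ? ? ?; apply/andP; split; lra.
  - have : 0 <= a * (- s) by rewrite mulr_ge0//; lra.
    by rewrite ler_norml => ? ? ? ?; apply/andP; split; lra.
  - have : 0 <= (- a) * s by rewrite mulr_ge0//; lra.
    by rewrite ler_norml => ? ? ? ?; apply/andP; split; lra.
  - by rewrite ler_norml => ? ? ?; apply/andP; split; lra.
apply/is_derive_eps => e e0; exists e => // a ae.
apply: le_trans (quad a) _.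
by rewrite expr2 ler_wpM2r// ltW.
Qed.

(** * Invariance of polyhedra *)

Definition slack (R : realType) (d : nat) (c : R) (f : 'rV[R]_d) (x : 'cV[R]_d) : R :=
  c + lform f x.

Definition polyhedron (R : realType) (d : nat) (K : finType) (c : K -> R)
    (f : K -> 'rV[R]_d) : set 'cV[R]_d :=
  [set x | forall k, 0 <= slack (c k) (f k) x].

Definition violation (R : realType) (d : nat) (K : finType) (c : K -> R)
    (f : K -> 'rV[R]_d) (x : 'cV[R]_d) : R :=
  \sum_k negpart (slack (c k) (f k) x) ^+ 2.

(* Along [x' = A x] the violation grows at rate at most [2 C]. *)
Definition quasi_invariant (R : realType) (d : nat) (K : finType) (c : K -> R)
    (f : K -> 'rV[R]_d) (C : R) (A : 'M[R]_d) :=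
  forall x, \sum_k negpart (slack (c k) (f k) x) * - lform (f k) (A *m x)
    <= C * violation c f x.

Lemma violation_eq0 (R : realType) (d : nat) (K : finType) (c : K -> R)
    (f : K -> 'rV[R]_d) (x : 'cV[R]_d) :
  violation c f x <= 0 <-> polyhedron c f x.
Proof.
have v0 k : true -> 0 <= negpart (slack (c k) (f k) x) ^+ 2 by rewrite sqr_ge0.
split=> [V0 k|Px].
  have /eqP V0' : violation c f x = 0.
    by apply/eqP; rewrite eq_le V0 sumr_ge0.
  move: V0'; rewrite psumr_eq0// => /allP/(_ k); rewrite mem_index_enum => /(_ isT).
  by rewrite /= sqrf_eq0 negpart_eq0.
rewrite /violation big1// => k _; apply/eqP.
by rewrite sqrf_eq0 negpart_eq0; exact: Px.
Qed.

(** After factoring out [expR (- (a * s)) <= 1], this is [1 - expR (- r) <= r] for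
    [r = a * (t - s)]. *)
Lemma expR_decay_lip (R : realType) (a s t : R) : 0 <= a -> 0 <= s -> s <= t ->
  `|expR (- (a * t)) - expR (- (a * s))| <= a * (t - s).
Proof.
move=> a0 s0 st.
have at_s : a * s <= a * t by rewrite ler_wpM2l.
rewrite ler0_norm ?subr_le0 ?ler_expR ?lerN2// opprB.
have -> : expR (- (a * t)) = expR (- (a * s)) * expR (- (a * (t - s))).
  by rewrite -expRD; congr expR; ring.
have : expR (- (a * s)) <= 1 by rewrite expR_le1 oppr_le0 mulr_ge0.
have := expR_gt0 (- (a * s)); have := expR_ge1Dx (- (a * (t - s))).
have : 0 <= a * (t - s) by rewrite mulr_ge0// subr_ge0.
set p := expR _; set q := expR _; set r := a * (t - s); nra.
Qed.

(** The trajectory is bounded on [0, T], so every negative part is at most some [D]. There its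
    square is Lipschitz in the point and the exponential is Lipschitz in time, hence each product is
    controlled by [(v - u) + |x v - x u|]. *)
Lemma violation_decay_ac (R : realType) (d : nat) (K : finType) (c : K -> R)
    (f : K -> 'rV[R]_d) (a T : R) (x : R -> 'cV[R]_d) :
  0 <= a -> abs_continuous_on 0 T x ->
  abs_continuous_on 0 T
    (fun t => violation c f (x t) * expR (- (a * t)) : R^o).
Proof.
move=> a0 xac; have [B B0 xB] := abs_continuous_on_bounded xac.
have term k : exists2 L, 0 <= L & forall u v, 0 <= u -> u <= v -> v <= T ->
    `|negpart (slack (c k) (f k) (x v)) ^+ 2 * expR (- (a * v)) -
      negpart (slack (c k) (f k) (x u)) ^+ 2 * expR (- (a * u))| <=
    L * ((v - u) + `|x v - x u|).
  have [M M0 fM] := lform_norm_le (f k).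
  pose D := `|c k| + M * B.
  have D0 : 0 <= D by rewrite addr_ge0// mulr_ge0.
  have qD t : 0 <= t -> t <= T -> negpart (slack (c k) (f k) (x t)) <= D.
    move=> t0 tT; apply: le_trans (_ : `|slack (c k) (f k) (x t)| <= _).
      by rewrite /negpart ge_max normr_ge0 -normrN ler_norm.
    apply: le_trans (ler_normD _ _) _; rewrite lerD2l.
    by apply: le_trans (fM _) _; rewrite ler_wpM2l// xB.
  exists (2 * D * M + D ^+ 2 * a) => [|u v u0 uv vT].
    by rewrite addr_ge0 ?mulr_ge0 ?sqr_ge0.
  have lip : `|negpart (slack (c k) (f k) (x v)) - negpart (slack (c k) (f k) (x u))|
      <= M * `|x v - x u|.
    apply: le_trans (negpart_lip _ _) _.
    by rewrite /slack opprD addrACA subrr add0r -lformB fM.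
  have := qD u u0 (le_trans uv vT); have := qD v (le_trans u0 uv) vT.
  have := negpart_ge0 (slack (c k) (f k) (x u)).
  have := negpart_ge0 (slack (c k) (f k) (x v)).
  have := expR_decay_lip a0 u0 uv.
  have : expR (- (a * v)) <= 1.
    by rewrite expR_le1 oppr_le0 mulr_ge0// (le_trans u0).
  have := expR_gt0 (- (a * v)).
  move: lip; set p := negpart _; set q := negpart _; set r := expR _; set s := expR _.
  move=> lip r0 r1 rs p0 q0 pD qD'.
  have -> : p ^+ 2 * r - q ^+ 2 * s = (p + q) * r * (p - q) + q ^+ 2 * (r - s) by ring.
  apply: le_trans (ler_normD _ _) _.
  rewrite 2!normrM [`|_ * (r - s)|]normrM.
  have n0 : 0 <= `|x v - x u| by [].
  have d0 : 0 <= v - u by rewrite subr_ge0.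
  have h1 : `|p + q| * `|r| * `|p - q| <= 2 * D * M * `|x v - x u|.
    rewrite -[leRHS]mulrA ler_pM//; rewrite ?mulr_ge0//.
    rewrite (ger0_norm (ltW r0)) ger0_norm ?addr_ge0//.
    rewrite -[leRHS]mulr1 ler_pM ?addr_ge0 ?(ltW r0)//; lra.
  have h2 : `|q ^+ 2| * `|r - s| <= D ^+ 2 * a * (v - u).
    by rewrite -[leRHS]mulrA ler_pM// ger0_norm ?sqr_ge0// lerXn2r.
  have : 0 <= 2 * D * M * (v - u) by rewrite !mulr_ge0.
  have : 0 <= D ^+ 2 * a * `|x v - x u| by rewrite !mulr_ge0// sqr_ge0.
  lra.
pose L k := projT1 (cid2 (term k)).
apply: (abs_continuous_on_control (L := \sum_k L k) _ xac).
  by apply: sumr_ge0 => k _; rewrite /L; case: cid2.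
move=> u v u0 uv vT; rewrite /violation !mulr_suml -sumrB.
apply: le_trans (ler_norm_sum _ _ _) _; apply: ler_sum => k _.
by rewrite /L; case: cid2 => /= l _; exact.
Qed.

Lemma is_derive_violation (R : realType) (d : nat) (K : finType) (c : K -> R)
    (f : K -> 'rV[R]_d) (x : R -> 'cV[R]_d) (t : R) (l : 'cV[R]_d) :
  is_derive (t : R^o) 1 (x : R^o -> 'cV[R]_d) l ->
  is_derive (t : R^o) 1 (fun s => violation c f (x s) : R^o)
    (2 * \sum_k negpart (slack (c k) (f k) (x t)) * - lform (f k) l).
Proof.
move=> xl; rewrite mulr_sumr.
rewrite (_ : (fun s => _) =
    \sum_k ((fun s => negpart s ^+ 2) \o (fun s => slack (c k) (f k) (x s)))); last first.
  by apply/funext => s; rewrite fct_sumE.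
apply: (big_ind2 (fun g l => is_derive (t : R^o) 1 (g : R^o -> R^o) l)).
- exact: is_derive_cst.
- by move=> g1 l1 g2 l2 ? ?; exact: is_deriveD.
move=> k _.
have -> : 2 * (negpart (slack (c k) (f k) (x t)) * - lform (f k) l) =
    - 2 * negpart (slack (c k) (f k) (x t)) * (0 + lform (f k) l) by ring.
apply: is_derive1_comp; first exact: is_derive_negpart_sqr.
apply: (@is_deriveD _ R^o R^o (cst (c k))); exact: is_derive_lform.
Qed.

(** Gronwall with an integrating factor: the violation times [expR (- (2 * C * t))] has a
    nonpositive derivative almost everywhere, so it cannot grow from its initial value, which is at
    most 0. *)
Lemma quasi_invariant_viable (R : realType) (d : nat) (K : finType) (c : K -> R)
    (f : K -> 'rV[R]_d) (C : R) (A : set 'M[R]_d) (x : R -> 'cV[R]_d) (T : R) :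
  0 <= C -> (forall a, A a -> quasi_invariant c f C a) ->
  trajectory A x -> polyhedron c f (x 0) -> 0 <= T -> polyhedron c f (x T).
Proof.
move=> C0 AC [xac [B [_ AB xB]]] Px0 T0.
pose h t := violation c f (x t) * expR (- (2 * C * t)).
have hT : h T <= h 0.
  apply: ac_nonincreasing => //.
    apply: violation_decay_ac; first by rewrite mulr_ge0.
    exact: xac.
  apply: negligibleS xB => t; apply: contra_not => xB /andP[t0 _].
  have /(is_derive_violation c f) Dv := xB t0.
  have De : is_derive (t : R^o) 1 (fun s => expR (- (2 * C * s)) : R^o)
      (expR (- (2 * C * t)) * - (2 * C)).
    apply: (@is_derive1_comp _ expR (fun s => - (2 * C * s))).
    apply/is_derive_eps => e e0; exists 1 => // s _.
    rewrite [X in `|X|](_ : _ = 0) ?normr0 ?mulr_ge0 ?(ltW e0)//.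
    by rewrite /GRing.scale/=; ring.
  have Dh := is_deriveM Dv De; eexists; last exact: Dh.
  rewrite /GRing.scale/=.
  have := AC _ (AB t t0) (x t); set Q := \sum_k _; set V := violation _ _ _ => QV.
  have -> : V * (expR (- (2 * C * t)) * - (2 * C)) + expR (- (2 * C * t)) * (2 * Q)
    = expR (- (2 * C * t)) * (2 * (Q - C * V)) by ring.
  by rewrite mulr_ge0_le0 ?expR_ge0//; lra.
apply/violation_eq0; move/violation_eq0 : Px0 => Px0.
move: hT; rewrite /h mulr0 oppr0 expR0 mulr1 => hT.
have := expR_gt0 (- (2 * C * T)); nra.
Qed.

(** * Trajectories and reachability *)

Lemma sub_itv_trivIset (R : realType) (n : nat) (u v u' v' : 'I_n -> R) :
  (forall i, `]u' i, v' i[%classic `<=` `]u i, v i[%classic) ->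
  trivIset [set: 'I_n] (fun i => `]u i, v i[%classic) ->
  trivIset [set: 'I_n] (fun i => `]u' i, v' i[%classic).
Proof.
move=> sub dis i j Di Dj [x [xi xj]].
by apply: dis => //; exists x; split; exact: sub.
Qed.

Definition splice (R : realType) (W : Type) (t : R) (x y : R -> W) (s : R) : W :=
  if s <= t then x s else y s.

(** Clipping times at [t] from above ([lo]) and from below ([hi]) writes the splice as
    [x (lo a) + y (hi a) - y t]. Both clipped families of intervals remain disjoint and do not
    become longer, so each piece contributes less than [e / 2]. *)
Lemma splice_abs_continuous (R : realType) (W : normedModType R) (t T : R)
    (x y : R -> W) :
  0 <= t -> x t = y t -> (forall S, 0 <= S -> abs_continuous_on 0 S x) ->
  (forall S, 0 <= S -> abs_continuous_on 0 S y) ->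
  0 <= T -> abs_continuous_on 0 T (splice t x y).
Proof.
move=> t0 xyt xac yac T0 e e0.
pose S := Num.max t T.
have S0 : 0 <= S by rewrite le_max t0.
have tS : t <= S by rewrite le_max lexx.
have TS : T <= S by rewrite le_max lexx orbT.
have e2 : 0 < e / 2 by rewrite divr_gt0.
have [d d0 xd] := xac S S0 _ e2.
have [d' d'0 yd] := yac S S0 _ e2.
exists (Num.min d d'); first by rewrite lt_min d0.
move=> n u v uv dis; rewrite lt_min => /andP[sd sd'].
pose lo a := Num.min a t; pose hi a := Num.max a t.
have loP a : (a <= t /\ lo a = a) \/ (t <= a /\ lo a = t).
  by rewrite /lo; case: (leP a t) => at_; [left|right; rewrite ltW].
have hiP a : (a <= t /\ hi a = t) \/ (t <= a /\ hi a = a).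
  by rewrite /hi; case: (leP a t) => at_; [left|right; rewrite ltW].
have spliceE a : splice t x y a = x (lo a) + y (hi a) - y t.
  rewrite /splice /lo /hi; case: leP => at_; first by rewrite addrK.
  by rewrite xyt addrAC subrr add0r.
have {xd} xd : \sum_i `|x (lo (v i)) - x (lo (u i))| < e / 2.
  apply: (xd n (lo \o u) (lo \o v)).
  - by move=> i; have := uv i; rewrite /=; case: (loP (u i)) => -[? ->];
      case: (loP (v i)) => -[? ->]; lra.
  - apply: sub_itv_trivIset dis => i z; rewrite /= !in_itv/=.
    by case: (loP (u i)) => -[? ->]; case: (loP (v i)) => -[? ->] /andP[? ?];
      apply/andP; split; lra.
  - apply: le_lt_trans sd; apply: ler_sum => i _; have := uv i; rewrite /=.
    by case: (loP (u i)) => -[? ->]; case: (loP (v i)) => -[? ->]; lra.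
have {yd} yd : \sum_i `|y (hi (v i)) - y (hi (u i))| < e / 2.
  apply: (yd n (hi \o u) (hi \o v)).
  - by move=> i; have := uv i; rewrite /=; case: (hiP (u i)) => -[? ->];
      case: (hiP (v i)) => -[? ->]; lra.
  - apply: sub_itv_trivIset dis => i z; rewrite /= !in_itv/=.
    by case: (hiP (u i)) => -[? ->]; case: (hiP (v i)) => -[? ->] /andP[? ?];
      apply/andP; split; lra.
  - apply: le_lt_trans sd'; apply: ler_sum => i _; have := uv i; rewrite /=.
    by case: (hiP (u i)) => -[? ->]; case: (hiP (v i)) => -[? ->]; lra.
rewrite (splitr e); apply: le_lt_trans (ltrD xd yd).
rewrite -big_split/=; apply: ler_sum => i _.
rewrite !spliceE [X in `|X|](_ : _ = (x (lo (v i)) - x (lo (u i))) +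
  (y (hi (v i)) - y (hi (u i)))); first exact: ler_normD.
by rewrite !opprD !opprK addrACA addNr addr0 addrACA.
Qed.

Lemma completed_measurable_ltr (R : realType) (D : set R) (t : R) :
  @measurable_fun _ _
    (g_sigma_algebraType (completed_algebra_gen (@lebesgue_measure R))) bool
    D (fun s : R => s <= t).
Proof.
move=> mD; apply: (measurable_fun_bool true) => //.
apply: measurableI => //; apply: sub_sigma_algebra.
exists `]-oo, t]%classic; first exact: measurable_itv.
exists set0; first exact: negligible_set0.
by rewrite setU0; apply/seteqP; split => s; rewrite /= in_itv.
Qed.

Lemma splice_measurable (R : realType) (t : R) (f g : R -> R) :
  lebesgue_measurable_fun `[0, +oo[%classic f ->
  lebesgue_measurable_fun `[0, +oo[%classic g ->
  lebesgue_measurable_fun `[0, +oo[%classic (splice t f g).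
Proof.
move=> mf mg mD; move: (mD).
apply: (@measurable_fun_if _ _
  (g_sigma_algebraType (completed_algebra_gen (@lebesgue_measure R)))
  (measurableTypeR R)) => //.
- exact: completed_measurable_ltr.
- by apply: (measurable_funS mD) => // s [].
- by apply: (measurable_funS mD) => // s [].
Qed.

Lemma is_derive_local (R : realType) (W : normedModType R) (x y : R -> W)
    (t r : R) (l : W) :
  0 < r -> (forall s, `|s - t| < r -> x s = y s) ->
  is_derive (t : R^o) 1 (x : R^o -> W) l -> is_derive (t : R^o) 1 (y : R^o -> W) l.
Proof.
move=> r0 xy /is_derive_eps xl; apply/is_derive_eps => e /xl[d d0 xd].
exists (Num.min r d); first by rewrite lt_min r0.
move=> s; rewrite lt_min => /andP[sr sd].
by rewrite -!xy ?subrr ?normr0//; exact: xd.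
Qed.

Lemma splice_trajectory (R : realType) (d : nat) (A : set 'M[R]_d) (t : R)
    (x y : R -> 'cV[R]_d) :
  0 <= t -> x t = y t -> trajectory A x -> trajectory A y ->
  trajectory A (splice t x y).
Proof.
move=> t0 xyt [xac [B [Bm AB xB]]] [yac [B' [Bm' AB' yB]]].
split; first by move=> T T0; exact: splice_abs_continuous.
exists (splice t B B'); split.
- move=> i j; rewrite (_ : (fun s => _) =
      splice t (fun s => B s i j) (fun s => B' s i j)).
    exact: splice_measurable.
  by apply/funext => s; rewrite /splice; case: ifP.
- by move=> s s0; rewrite /splice; case: ifP => _; [exact: AB|exact: AB'].
(* The gluing time, where the splice may fail to be differentiable, is added to the null set. *)
have nt : (@lebesgue_measure R).-negligible [set t].
  exists [set t]; split => //.
  by rewrite lebesgue_measure_set1.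
have := negligibleU (negligibleU xB yB) nt.
apply: negligibleS => s; apply: contra_notP => /not_orP[/not_orP[]].
move=> /contrapT xs /contrapT ys /eqP st s0.
(* Within distance [|s - t|] of [s] the splice coincides with a single one of its pieces. *)
have r0 : 0 < `|s - t| by rewrite normr_gt0 subr_eq0.
have sw z : `|z - s| < `|s - t| -> (z <= t) = (s <= t).
  by case: (ger0P (s - t)) => st0; rewrite ltr_norml => /andP[? ?];
    apply/idP/idP; lra.
rewrite /splice; case: (leP s t) => st'.
  apply: is_derive_local (xs s0) => [|z /sw ->]; first exact: r0.
  by rewrite st'.
apply: is_derive_local (ys s0) => [|z /sw ->]; first exact: r0.
by rewrite leNgt st'.
Qed.

(** The Heine-Borel property of row vectors is carried over to matrices by [mxvec] and its
    continuous inverse [vec_mx]. *)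
Lemma mx_bounded_closed_compact (R : realType) (m n : nat) (A : set 'M[R]_(m, n)) :
  (exists B : R, forall a, A a -> `|a| <= B) -> closed A -> compact A.
Proof.
move=> [B AB] Acl.
have norm_vec (a : 'M[R]_(m, n)) : `|mxvec a| <= `|a|.
  rewrite [leLHS]/Num.Def.normr/= mx_normrE; apply: bigmax_le => // -[i k] _ /=.
  by rewrite ord1; case/mxvec_indexP: k => a' b'; rewrite mxvecE ler_entry_norm.
have cvec : continuous (@vec_mx R m n).
  move=> v; apply/(@cvgrPdist_le _ _ _ _ (nbhs_filter v)) => e e0.
  apply/nbhs_ballP; exists e => //= w; rewrite mx_norm_ball => vw.
  rewrite -linearB/= [leLHS]/Num.Def.normr/= mx_normrE.
  apply: bigmax_le => [|[i j] _ /=]; first exact: ltW.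
  rewrite mxE; apply: le_trans (ler_entry_norm _ _ _) _.
  exact: ltW.
have -> : A = vec_mx @` (mxvec @` A).
  apply/seteqP; split=> [a Aa|_ [_ [a Aa <-] <-]]; last by rewrite mxvecK.
  by exists (mxvec a); [exists a|rewrite mxvecK].
apply: continuous_compact; first exact: continuous_subspaceT.
have vecE : mxvec @` A = vec_mx @^-1` A.
  apply/seteqP; split=> [_ [a Aa <-]|v Av]; first by rewrite /= mxvecK.
  by exists (vec_mx v) => //; rewrite vec_mxK.
apply: bounded_closed_compact.
  exists B; split; first exact: num_real.
  move=> C BC _ [a Aa <-].
  by apply: le_trans (norm_vec a) _; apply: le_trans (AB a Aa) _; exact: ltW.
by rewrite vecE; apply: closed_comp => // v _; exact: cvec.
Qed.

Lemma continuous_fsum (R : realType) (T : topologicalType) (I : finType)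
    (F : I -> T -> R) :
  (forall i, continuous (F i)) -> continuous (fun t => \sum_i F i t).
Proof.
move=> cF t; 
rewrite (_ : (fun _ => _) = \sum_i F i); last by apply/funext => s; rewrite fct_sumE.
apply: (big_ind (fun g : T -> R => {for t, continuous g})).
- exact: cst_continuous.
- by move=> g h cg ch; exact: continuousD.
- by move=> i _; exact: cF.
Qed.

Lemma continuous_mulrl (R : realType) (T : topologicalType) (a : R) (g : T -> R) :
  continuous g -> continuous (fun t => a * g t).
Proof. by move=> cg t; apply: (cvgM (cvg_cst a) (cg t)). Qed.

Lemma continuous_lform_mulmx (R : realType) (m n : nat) (f : 'rV[R]_m)
    (x : 'cV[R]_n) : continuous (fun A : 'M[R]_(m, n) => lform f (A *m x)).
Proof.
rewrite (_ : (fun _ => _) = fun A : 'M[R]_(m, n) =>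
    \sum_i f 0 i * \sum_j x j 0 * A i j).
  apply: continuous_fsum => i; apply: continuous_mulrl.
  by apply: continuous_fsum => j; apply: continuous_mulrl; exact: coord_continuous.
apply/funext => A; rewrite lformE; apply: eq_bigr => i _.
by rewrite mxE; congr (_ * _); apply: eq_bigr => j _; rewrite mulrC.
Qed.

Lemma continuous_lform (R : realType) (m : nat) (f : 'rV[R]_m) :
  continuous (lform f).
Proof.
rewrite (_ : lform f = fun x : 'cV[R]_m => \sum_i f 0 i * x i 0).
  apply: continuous_fsum => i; apply: continuous_mulrl; exact: coord_continuous.
by apply/funext => x; exact: lformE.
Qed.

Lemma abs_continuous_on_cst (R : realType) (W : normedModType R) (a b : R) (w : W) :
  abs_continuous_on a b (fun=> w).
Proof.
by move=> e e0; exists 1 => // n u v _ _ _; rewrite big1// => i _; rewrite subrr normr0.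
Qed.

(** This is the solution of [x' = a x] through [w + z] at time [t]: the part [w] in the kernel
    rests, and the eigenvector [z] for -1 decays. With [z = 0] it gives the constant
    trajectories. *)
Lemma exp_trajectory (R : realType) (d : nat) (A : set 'M[R]_d) (a : 'M[R]_d)
    (w z : 'cV[R]_d) (t : R) :
  A a -> a *m w = 0 -> a *m z = - z ->
  trajectory A (fun s => w + expR (t - s) *: z).
Proof.
move=> Aa aw az; split=> [T T0|].
  apply: (@abs_continuous_on_control _ _ _ 0 T (expR t * `|z|) (fun=> 0 : R^o)).
  - by rewrite mulr_ge0 ?expR_ge0.
  - exact: abs_continuous_on_cst.
  move=> u v u0 uv _; rewrite subrr normr0 addr0.
  rewrite opprD addrACA subrr add0r -scalerBl normrZ [leRHS]mulrAC ler_wpM2r//.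
  rewrite !expRD -mulrBr normrM ger0_norm ?expR_ge0// ler_wpM2l ?expR_ge0//.
  by have := @expR_decay_lip R 1 u v ler01 u0 uv; rewrite !mul1r.
exists (fun=> a); split => //; first by move=> i j; exact: measurable_cst.
exists set0; split => // s /=; case => _.
have De : is_derive (s : R^o) 1 (fun r => expR (t - r) : R^o) (expR (t - s) * -1).
  apply: (@is_derive1_comp _ expR (fun r => t - r)).
  apply/is_derive_eps => e e0; exists 1 => // r _.
  rewrite [X in `|X|](_ : _ = 0) ?normr0 ?mulr_ge0 ?(ltW e0)//.
  by rewrite /GRing.scale/=; ring.
have -> : a *m (w + expR (t - s) *: z) = 0 + (expR (t - s) * -1) *: z.
  by rewrite mulmxDr aw -scalemxAr az mulrN1 scalerN scaleNr.
apply: (@is_deriveD _ R^o _ (cst w)).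
apply: (@is_derive_bounded_linear _ R^o _ (fun r => r *: z) `|z| _ s) De => //.
- by move=> r r'; rewrite scalerBl.
- by move=> r r'; rewrite scalerA.
- by move=> r; rewrite normrZ mulrC.
Qed.

Lemma polyhedron_segment (R : realType) (d : nat) (K : finType) (c : K -> R)
    (f : K -> 'rV[R]_d) (y z : 'cV[R]_d) (r s : R) :
  polyhedron c f y -> polyhedron c f (y + s *: z) -> 0 <= r -> r <= s ->
  polyhedron c f (y + r *: z).
Proof.
move=> Py Psz r0 rs k; have := Py k; have := Psz k.
rewrite /slack !lformD !lformZ; set p := lform _ y; set q := lform _ z => h1 h2.
have [s0|s0] := eqVneq s 0; first by (have -> : r = 0 by lra); lra.
have {s0} s0 : 0 < s by rewrite lt_neqAle eq_sym s0 (le_trans r0).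
rewrite -(pmulr_rge0 _ s0).
have -> : s * (c k + (p + r * q)) = (s - r) * (c k + p) + r * (c k + (p + s * q)) by ring.
by rewrite addr_ge0 ?mulr_ge0 ?subr_ge0.
Qed.

Lemma reach_stationary (R : realType) (d : nat) (A : set 'M[R]_d)
    (M : set 'cV[R]_d) (u y : 'cV[R]_d) (phi : 'rV[R]_d) (t : R) :
  A (u *m phi) -> M y -> lform phi y = 0 -> reach A M t y.
Proof.
move=> Aup My phiy; exists (fun s => y + expR (0 - s) *: 0).
rewrite !scaler0 !addr0; split => //.
by apply: exp_trajectory Aup _ _; rewrite ?mulmx0 ?oppr0// mul_dyad phiy scale0r.
Qed.

(* [y - theta *: (lform phi y *: u)] flows to [y] under [x' = lform phi x *: u]. *)
Lemma reach_flow (R : realType) (d : nat) (K : finType) (c : K -> R)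
    (f : K -> 'rV[R]_d) (A : set 'M[R]_d) (u y : 'cV[R]_d) (phi : 'rV[R]_d)
    (theta : R) :
  A (u *m phi) -> lform phi u = -1 -> 0 <= theta ->
  polyhedron c f y -> polyhedron c f (y - (theta * lform phi y) *: u) ->
  (forall t, 0 <= t ->
     reach A (polyhedron c f) t (y - (theta * lform phi y) *: u)) ->
  forall t, 0 <= t -> reach A (polyhedron c f) t y.
Proof.
move=> Aup phiu th0 Py Py' back t t0.
pose z := - lform phi y *: u.
have y'E : y - (theta * lform phi y) *: u = y + theta *: z.
  by rewrite /z scalerA mulrN scaleNr.
rewrite y'E in Py' back.
(* Since [lform phi u = -1], the vector [y - z] is killed by [phi] and [z] is an eigenvector for -1.
   Thus [g] arrives at [y] at time [t], and it passes [y + theta *: z] at time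
   [t - ln (1 + theta)]. *)
pose g s := (y - z) + expR (t - s) *: z.
have gE s : g s = y + (expR (t - s) - 1) *: z.
  by rewrite /g scalerBl scale1r addrAC addrA.
have gt : trajectory A g.
  apply: exp_trajectory Aup _ _.
    by rewrite mul_dyad lformB lformZ phiu mulrN1 opprK subrr scale0r.
  by rewrite mul_dyad lformZ phiu mulrN1 opprK /z scaleNr opprK.
have th1 : 0 < 1 + theta by rewrite ltr_wpDr.
(* If [t] is short, [g] already starts on the segment from [y] to [y + theta *: z]. Otherwise it is
   preceded by a trajectory that ends at [y + theta *: z]. *)
have [ttau|taut] := leP t (ln (1 + theta)).
  exists g; split => //; last by rewrite gE subrr expR0 subrr scale0r addr0.
  rewrite gE subr0; apply: polyhedron_segment Py Py' _ _.
    by rewrite subr_ge0 -expR0 ler_expR.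
  by rewrite lerBlDl -(lnK th1) ler_expR.
have s0 : 0 <= t - ln (1 + theta) by rewrite subr_ge0 ltW.
have [x [xt Px0 xs]] := back _ s0.
exists (splice (t - ln (1 + theta)) x g); split.
- apply: splice_trajectory => //.
  by rewrite -xs gE opprB addrCA subrr addr0 lnK// addrAC subrr add0r.
- by rewrite /splice s0.
- rewrite /splice; case: leP => [le_t|_]; last first.
    by rewrite gE subrr expR0 subrr scale0r addr0.
  (* The splice takes its first piece at the gluing time itself; that time equals [t] only if
     [theta = 0], and then both endpoints coincide. *)
  have -> : t = t - ln (1 + theta).
    apply/eqP; rewrite eq_le le_t gerBl ln_ge0//; lra.
  rewrite -xs; suff -> : theta = 0 by rewrite scale0r addr0.
  apply/eqP; rewrite eq_le th0 andbT leNgt; apply/negP => th.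
  have : 0 < ln (1 + theta) by rewrite ln_gt0// ltrDl.
  lra.
Qed.

(** * A criterion for realizability *)

Definition dissipative_system (R : realType) (d : nat) (K : finType) (c : K -> R)
    (f : K -> 'rV[R]_d) (C : R) : set 'M[R]_d :=
  [set A | [/\ `|A| <= C, \tr A = -1 & quasi_invariant c f C A]].

(** For each fixed [x] the quasi-invariance inequality is linear in the matrix, so it cuts out a
    closed half-space or a trivial set; all conditions together define a closed bounded set. *)
Lemma dissipative_compact (R : realType) (d : nat) (K : finType) (c : K -> R)
    (f : K -> 'rV[R]_d) (C : R) : compact (dissipative_system c f C).
Proof.
apply: mx_bounded_closed_compact; first by exists C => a [].
have -> : dissipative_system c f C =
    [set A | `|A| <= C] `&` [set A | \tr A = -1] `&`
    \bigcap_(x in setT) [set A | \sum_k - negpart (slack (c k) (f k) x) *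
       lform (f k) (A *m x) <= C * violation c f x].
  have sumE A x : \sum_k - negpart (slack (c k) (f k) x) * lform (f k) (A *m x) =
      \sum_k negpart (slack (c k) (f k) x) * - lform (f k) (A *m x).
    by apply: eq_bigr => k _; rewrite mulrN mulNr.
  apply/seteqP; split=> [A [nA tA qA]|A [[nA tA] qA]].
    by split=> [|x _]; [split|rewrite /= sumE; exact: qA].
  by split=> // x; rewrite -sumE; exact: qA.
apply: closedI; [apply: closedI|apply: closed_bigI => x _].
- apply: (@closed_comp _ _ (@Num.norm _ 'M[R]_d) [set r | r <= C]).
    by move=> ? _; exact: norm_continuous.
  exact: closed_le.
- apply: (@closed_comp _ _ (fun A : 'M[R]_d => \tr A) [set r | r = -1]).
    by move=> A _; apply: continuous_fsum => i; exact: coord_continuous.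
  exact: closed_eq.
- apply: (@closed_comp _ _ (fun A : 'M[R]_d => \sum_k - negpart (slack (c k) (f k) x) *
       lform (f k) (A *m x)) [set r | r <= C * violation c f x]).
    move=> A _; apply: continuous_fsum => k; apply: continuous_mulrl.
    exact: continuous_lform_mulmx.
  exact: closed_le.
Qed.

Lemma dissipative_convex (R : realType) (d : nat) (K : finType) (c : K -> R)
    (f : K -> 'rV[R]_d) (C : R) : convex_set (dissipative_system c f C).
Proof.
move=> a b l; rewrite !inE => -[na ta qa] [nb tb qb].
have r0 : 0 <= l%:num :> R by [].
have r1 : 0 <= 1 - l%:num :> R by rewrite subr_ge0.
set r := l%:num in r0 r1.
rewrite [conv _ _ _](_ : _ = r *: a + (1 - r) *: b)//.
split.
- apply: le_trans (ler_normD _ _) _; rewrite !normrZ !ger0_norm//.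
  have := ler_wpM2l r0 na; have := ler_wpM2l r1 nb; lra.
- by rewrite mxtraceD !mxtraceZ ta tb; ring.
- move=> x.
  have -> : \sum_k negpart (slack (c k) (f k) x) *
        - lform (f k) ((r *: a + (1 - r) *: b) *m x) =
      r * (\sum_k negpart (slack (c k) (f k) x) * - lform (f k) (a *m x)) +
      (1 - r) * (\sum_k negpart (slack (c k) (f k) x) * - lform (f k) (b *m x)).
    rewrite !mulr_sumr -big_split/=; apply: eq_bigr => k _.
    by rewrite mulmxDl -!scalemxAl lformD !lformZ; ring.
  have := ler_wpM2l r0 (qa x); have := ler_wpM2l r1 (qb x); lra.
Qed.

(** A nonzero constant trajectory admits no bound [C * expR (b * t)] with [b < 0]. *)
Lemma lyapunov_exponent_ge0 (R : realType) (d : nat) (A : set 'M[R]_d)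
    (y : 'cV[R]_d) :
  y != 0 -> trajectory A (fun=> y) -> 0 <= lyapunov_exponent A.
Proof.
move=> y0 yt; rewrite /lyapunov_exponent; set S := [set beta | _].
(* The infimum of the empty set is 0 by convention. *)
have [SE|/set0P[b0 Sb0]] := eqVneq S set0.
  by rewrite SE inf0 lexx.
apply: lb_le_inf; first by exists b0.
move=> b /(_ _ yt)[C yC]; rewrite leNgt; apply/negP => b_lt0.
have y_gt0 : 0 < `|y| by rewrite normr_gt0.
have C0 : `|y| <= C by have := yC 0 (lexx _); rewrite mulr0 expR0 mulr1.
(* At this time [- (b * t) = C / |y|], and [expR r >= 1 + r] turns the bound into [|y| + C <= C]. *)
pose t := C / `|y| * (- b^-1).
have t0 : 0 <= t.
  by rewrite mulr_ge0 ?divr_ge0 ?(le_trans _ C0) ?oppr_ge0 ?invr_le0 ?ltW.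
have := yC t t0; rewrite -ler_pdivrMr ?expR_gt0// -expRN.
have -> : - (b * t) = C / `|y| by rewrite /t; field; rewrite normr_eq0 y0 lt_eqF.
have := expR_ge1Dx (C / `|y|) => h1 h2.
have : `|y| * (1 + C / `|y|) <= C by apply: le_trans h2; rewrite ler_pM2l.
by rewrite mulrDr mulrCA divff ?gt_eqF//; lra.
Qed.

Lemma lform_kernel (R : realType) (d : nat) (phi : 'rV[R]_d) :
  (2 <= d)%N -> exists2 y, y != 0 & lform phi y = 0.
Proof.
move=> d2.
have /rowV0Pn[y /sub_kermxP yphi y0] : kermx phi^T != 0.
  rewrite -mxrank_eq0 mxrank_ker -lt0n subn_gt0.
  by apply: leq_ltn_trans d2; exact: rank_leq_col.
exists y^T; first by rewrite trmx_eq0.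
by rewrite /lform -[phi]trmxK -trmx_mul yphi trmx0 mxE.
Qed.

(** [G] singles out rank-one generators inside the dissipative system. They suffice for
    irreducibility and for reachability, both of which persist in any larger system, while
    invariance holds for all dissipative matrices. Reachability is therefore assumed for an
    arbitrary [A] containing the generators. *)
Theorem polyhedron_realizable (R : realType) (d : nat) (K : finType) (c : K -> R)
    (f : K -> 'rV[R]_d) (G : 'cV[R]_d -> 'rV[R]_d -> Prop) (C : R) :
  (2 <= d)%N ->
  (exists B : R, forall x, polyhedron c f x -> `|x| <= B) ->
  (exists2 x, polyhedron c f x & x != 0) ->
  (forall u phi, G u phi ->
    [/\ `|u *m phi| <= C, lform phi u = -1 & quasi_invariant c f C (u *m phi)]) ->
  (forall V : {vspace 'cV[R]_d},
    (forall u phi, G u phi -> forall y, y \in V -> lform phi y *: u \in V) ->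
    V != 0%VS -> V = fullv) ->
  (exists u phi, G u phi) ->
  (forall A : set 'M[R]_d, (forall u phi, G u phi -> A (u *m phi)) ->
    forall y, polyhedron c f y -> forall t, 0 <= t -> reach A (polyhedron c f) t y) ->
  realizable (polyhedron c f).
Proof.
move=> d2 [B bP] [x0 Px0 x0n] GP irr [u0 [phi0 Gu0]] back.
(* A nonzero equilibrium of one generator, which makes the Lyapunov exponent nonnegative. *)
have [y0 y0n phiy0] := lform_kernel phi0 d2.
set M := polyhedron c f.
have C0 : 0 <= C by have [+ _ _] := GP _ _ Gu0; apply: le_trans.
pose A := dissipative_system c f C.
have GA u phi : G u phi -> A (u *m phi).
  by move=> /GP[nC phiu qi]; split => //; rewrite trace_dyad.
have sigma0 : 0 <= lyapunov_exponent A.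
  apply: (lyapunov_exponent_ge0 y0n).
  have := @exp_trajectory _ _ A _ y0 0 0 (GA _ _ Gu0).
  rewrite mul_dyad phiy0 scale0r mulmx0 oppr0 => /(_ erefl erefl).
  by congr trajectory; apply/funext => s; rewrite scaler0 addr0.
exists A; split.
- split.
  + by exists (u0 *m phi0); exact: GA.
  + exact: dissipative_compact.
  + exact: dissipative_convex.
  + move=> [a [_ tra _]] /eqP; rewrite subr_eq0 => /eqP aE.
    move: tra; rewrite aE mxtrace_scalar => /eqP; apply/negP.
    by rewrite gt_eqF// (lt_le_trans (ltrN10 _))// mulrn_wge0.
- move=> V AV; have [->|V0] := eqVneq V 0%VS; [by left|right].
  apply: irr V0 => u phi /GA Aup y yV.
  by rewrite -mul_dyad; exact: AV.
- split.
  + apply: mx_bounded_closed_compact; first by exists B.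
    rewrite (_ : M = \bigcap_(k in setT) [set x | 0 <= slack (c k) (f k) x]).
      apply: closed_bigI => k _.
      apply: (@closed_comp _ _ (fun x : 'cV[R]_d => slack (c k) (f k) x) [set r | 0 <= r]).
        move=> x _; exact: (@cvgD _ _ _ _ _ (cst (c k)) (lform (f k)) (c k)
          (lform (f k) x) (cvg_cst _) (@continuous_lform _ _ (f k) x)).
      exact: closed_ge.
    by apply/seteqP; split => [x Px k _|x Px k]; exact: Px.
  + by exists x0.
  + by move=> M0; have : M x0 by []; rewrite M0 => /eqP; apply/negP.
  + exists 0 => t t0; rewrite mul0r expR0.
    have -> : [set 1 *: y | y in M] = M.
      by apply/seteqP; split => [_ [y My <-]|y My]; [|exists y]; rewrite ?scale1r.
    apply/seteqP; split => [y [x [xt Px ->]]|y Py]; last exact: back.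
    by apply: (quasi_invariant_viable C0 _ xt) => // a [].
Qed.

(** * Simplices *)

Lemma dual_basis (R : realType) (d : nat) (e : 'I_d -> 'cV[R]_d) :
  free [tuple e i | i < d] ->
  exists phi : 'I_d -> 'rV[R]_d,
    (forall i j, lform (phi i) (e j) = (i == j)%:R) /\
    (forall x, x = \sum_i lform (phi i) x *: e i).
Proof.
set X := [tuple e i | i < d] => Xfree.
have XE (i : 'I_d) : X`_i = e i by rewrite -tnth_nth tnth_mktuple.
have /span_basis Xfull : basis_of fullv X.
  by rewrite basisEfree Xfree subvf dimvf size_tuple [dim _]dim_matrix mulr1 leqnn.
exists (fun i => \row_j coord X i (delta_mx j 0)).
have phiE i x : lform (\row_j coord X i (delta_mx j 0)) x = coord X i x.
  rewrite lformE [in RHS](matrix_sum_delta x) linear_sum/=; apply: eq_bigr => j _.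
  by rewrite mxE big_ord1 linearZ/= mulrC.
split=> [i j|x]; first by rewrite phiE -XE coord_free// eq_sym.
have xX : x \in <<X>>%VS by rewrite Xfull memvf.
rewrite {1}(coord_span xX); apply: eq_bigr => i _.
by rewrite phiE XE.
Qed.

(** The slacks are the barycentric coordinates: [f k] is the linear part of the [k]-th one, and
    [c k] is its value at the origin. *)
Definition barycentric (R : realType) (d : nat) (v : 'I_d.+1 -> 'cV[R]_d)
    (c : 'I_d.+1 -> R) (f : 'I_d.+1 -> 'rV[R]_d) :=
  [/\ forall k l, slack (c k) (f k) (v l) = (k == l)%:R,
      forall x, \sum_k slack (c k) (f k) x = 1 &
      forall x, x = \sum_k slack (c k) (f k) x *: v k].

(** The functionals dual to the edges at [v ord0], evaluated at [x - v ord0], are the coordinates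
    with nonzero index; coordinate 0 is 1 minus their sum. *)
Lemma barycentric_exists (R : realType) (d : nat) (v : 'I_d.+1 -> 'cV[R]_d) :
  affinely_independent v -> exists c f, barycentric v c f.
Proof.
move=> /dual_basis[phi [phi_e phi_x]].
pose c (k : 'I_d.+1) := if unlift ord0 k is Some i then - lform (phi i) (v ord0)
  else 1 + \sum_i lform (phi i) (v ord0).
pose f (k : 'I_d.+1) := if unlift ord0 k is Some i then phi i else - \sum_i phi i.
have slackS i x : slack (c (lift ord0 i)) (f (lift ord0 i)) x = lform (phi i) (x - v ord0).
  by rewrite /slack /c /f liftK lformB addrC.
have lform_sumphi x : lform (\sum_i phi i) x = \sum_i lform (phi i) x.
  by rewrite /lform mulmx_suml summxE.
have slack0 x : slack (c ord0) (f ord0) x = 1 - \sum_i lform (phi i) (x - v ord0).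
  rewrite /slack /c /f unlift_none lformNl lform_sumphi -addrA; congr (1 + _).
  have -> : \sum_i lform (phi i) (x - v ord0) =
      \sum_i lform (phi i) x - \sum_i lform (phi i) (v ord0).
    by rewrite -sumrB; apply: eq_bigr => i _; rewrite lformB.
  by rewrite opprB.
have sum1 x : \sum_k slack (c k) (f k) x = 1.
  rewrite big_ord_recl slack0 (eq_bigr _ (fun i _ => slackS i x)).
  by rewrite subrK.
exists c, f; split => //.
- move=> k l; case: (unliftP ord0 k) => [i ->|->].
    rewrite slackS; case: (unliftP ord0 l) => [j ->|->].
      by rewrite phi_e (inj_eq lift_inj).
    by rewrite subrr lform0.
  rewrite slack0; case: (unliftP ord0 l) => [j ->|->].
    rewrite (bigD1 j)//= phi_e eqxx big1 ?addr0 ?subrr//.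
    by move=> i /negPf ij; rewrite phi_e ij.
  by rewrite subrr big1 ?subr0// => i _; rewrite lform0.
- move=> x; rewrite big_ord_recl slack0.
  rewrite (eq_bigr _ (fun i _ => congr1 (fun s => s *: _) (slackS i x))).
  rewrite scalerBl scale1r -addrA addrC [- _ + _]addrC scaler_suml -sumrB.
  under eq_bigr do rewrite -scalerBr.
  by rewrite -phi_x subrK.
Qed.

Lemma simplex_polyhedron (R : realType) (d : nat) (v : 'I_d.+1 -> 'cV[R]_d)
    (c : 'I_d.+1 -> R) (f : 'I_d.+1 -> 'rV[R]_d) :
  barycentric v c f -> simplex v = polyhedron c f.
Proof.
move=> [sv s1 sx]; apply/seteqP; split=> [_ [l [l0 l1] <-] k|x Px].
  rewrite /slack lform_sum.
  have -> : c k = \sum_i l i * c k by rewrite -mulr_suml l1 mul1r.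
  rewrite -big_split/= sumr_ge0// => i _.
  by rewrite lformZ -mulrDr -/(slack _ _ _) sv mulr_ge0.
exists (fun k => slack (c k) (f k) x); last by rewrite -sx.
by split.
Qed.

(** A small positive multiple of [w] still belongs to the polyhedron, although it strictly lowers
    the slack [k] below its value [c k] at the origin. *)
Lemma interior_polyhedron (R : realType) (d : nat) (K : finType) (c : K -> R)
    (f : K -> 'rV[R]_d) (k : K) (w : 'cV[R]_d) :
  interior (polyhedron c f) 0 -> lform (f k) w < 0 -> 0 < c k.
Proof.
rewrite /interior => /nbhs_ballP[r /= r0 rP] fw.
pose s := r / 2 / (`|w| + 1).
have w1 : 0 < `|w| + 1 by rewrite ltr_wpDl.
have s0 : 0 < s by rewrite !divr_gt0.
have : polyhedron c f (s *: w).
  apply: rP; rewrite mx_norm_ball /= sub0r normrN normrZ gtr0_norm// /s.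
  rewrite mulrAC -mulrA; apply: (@le_lt_trans _ _ (r / 2)); last by lra.
  rewrite ger_pMr ?divr_gt0// ler_pdivrMr//; lra.
move/(_ k); rewrite /slack lformZ => h.
have : s * lform (f k) w < 0 by rewrite pmulr_rlt0.
lra.
Qed.

Lemma ler_term_sum (R : realType) (I : finType) (F : I -> R) (i : I) :
  (forall j, 0 <= F j) -> F i <= \sum_j F j.
Proof. by move=> F0; rewrite (bigD1 i)//= lerDl sumr_ge0. Qed.

Lemma ler_term2_sum (R : realType) (I : finType) (F : I -> R) (i j : I) :
  (forall j, 0 <= F j) -> i != j -> F i + F j <= \sum_k F k.
Proof.
move=> F0 ij; rewrite (bigD1 i)//= (bigD1 j) 1?eq_sym//= lerD2l lerDl.
exact: sumr_ge0.
Qed.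

Lemma sum_mul_delta (R : realType) (I : finType) (F : I -> R) (i : I) :
  \sum_k F k * (k == i)%:R = F i.
Proof.
rewrite (bigD1 i)//= eqxx mulr1 big1 ?addr0// => k /negPf ->.
by rewrite mulr0.
Qed.

Lemma dyad_norm_le (R : realType) (d : nat) (u : 'cV[R]_d) (phi : 'rV[R]_d) :
  `|u *m phi| <= `|u| * `|phi|.
Proof.
rewrite [leLHS]/Num.Def.normr/= mx_normrE; apply: bigmax_le => [|[i j] _ /=].
  by rewrite mulr_ge0.
by rewrite mxE big_ord1 normrM ler_pM// ler_entry_norm.
Qed.

Lemma quasi_invariant_le (R : realType) (d : nat) (K : finType) (c : K -> R)
    (f : K -> 'rV[R]_d) (C C' : R) (A : 'M[R]_d) :
  C <= C' -> quasi_invariant c f C A -> quasi_invariant c f C' A.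
Proof.
move=> CC' qA x; apply: le_trans (qA x) _; rewrite ler_wpM2r//.
by apply: sumr_ge0 => k _; exact: sqr_ge0.
Qed.

(* Mass moves between the barycentric coordinates [p i] and [p j] at rate
   [a * p i - b * p j]; the condition [a * c i = b * c j] makes this rate linear
   in the point, so that the origin is an equilibrium. *)
Definition exchange (R : realType) (d : nat) (v : 'I_d.+1 -> 'cV[R]_d)
    (c : 'I_d.+1 -> R) (f : 'I_d.+1 -> 'rV[R]_d) (u : 'cV[R]_d) (phi : 'rV[R]_d) :=
  exists i j a b, [/\ i != j, [/\ 0 <= a, 0 <= b & a + b = 1], a * c i = b * c j,
    u = v j - v i & phi = a *: f i - b *: f j].

Section Exchange.
Variables (R : realType) (d : nat) (v : 'I_d.+1 -> 'cV[R]_d).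
Variables (c : 'I_d.+1 -> R) (f : 'I_d.+1 -> 'rV[R]_d).
Hypothesis bar : barycentric v c f.

Local Notation p k x := (slack (c k) (f k) x).

Lemma lform_edge k i j : lform (f k) (v j - v i) = (k == j)%:R - (k == i)%:R.
Proof.
case: bar => sv _ _; rewrite -!sv /slack lformB opprD addrACA subrr add0r.
by [].
Qed.

Lemma slack_edge k x a i j :
  p k (x + a *: (v j - v i)) = p k x + a * ((k == j)%:R - (k == i)%:R).
Proof. by rewrite /slack lformD lformZ lform_edge addrA. Qed.

(** These are the linear parts of affine functions whose sum is the constant 1. *)
Lemma sum_lform_eq0 x : \sum_k lform (f k) x = 0.
Proof.
case: bar => _ s1 _; apply: (@addrI _ (\sum_k c k)).
rewrite -big_split/= addr0 -[LHS]/(\sum_k p k x) s1 -(s1 0).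
by apply: eq_bigr => k _; rewrite /slack lform0 addr0.
Qed.

Lemma lform_expand x : x = \sum_k lform (f k) x *: v k.
Proof.
case: bar => _ _ sx.
have c0 : \sum_k c k *: v k = 0.
  rewrite [RHS](sx 0); apply: eq_bigr => k _.
  by rewrite /slack lform0 addr0.
rewrite {1}(sx x) -[RHS]add0r -[X in _ = X + _]c0 -big_split/=; apply: eq_bigr => k _.
by rewrite -scalerDl.
Qed.

Lemma exchange_rate i j a b x : a * c i = b * c j ->
  lform (a *: f i - b *: f j) x = a * p i x - b * p j x.
Proof.
move=> ab; rewrite lformDl lformNl !lformZl /slack !mulrDr ab.
by rewrite opprD addrACA subrr add0r.
Qed.

Lemma exchange_eigen u phi : exchange v c f u phi -> lform phi u = -1.
Proof.
move=> [i [j [a [b [ij [_ _ ab1] _ -> ->]]]]].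
rewrite lformDl lformNl !lformZl !lform_edge !eqxx (negPf ij) eq_sym (negPf ij).
by rewrite sub0r subr0 mulr1 mulrN1 -opprD ab1.
Qed.

(** Only the coordinates [i] and [j] move, at opposite rates, so the sum is
    [(a * p i - b * p j) * (n i - n j)] with [n] the negative parts. The products [n i * p i] and
    [n j * p j] are nonpositive, and the mixed terms total at most [n i * n j] because
    [a + b = 1]. *)
Lemma exchange_quasi_invariant u phi :
  exchange v c f u phi -> quasi_invariant c f 1 (u *m phi).
Proof.
move=> [i [j [a [b [ij [a0 b0 ab1] ab -> ->]]]]] x.
rewrite mul_dyad; under eq_bigr do rewrite lformZ lform_edge.
set r := lform _ x; set n := fun k => negpart (p k x).
have -> : \sum_k negpart (p k x) * - (r * ((k == j)%:R - (k == i)%:R)) =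
    r * (n i - n j).
  rewrite -[in RHS](sum_mul_delta n i) -[in RHS](sum_mul_delta n j) -sumrB mulr_sumr.
  by apply: eq_bigr => k _; rewrite /n; ring.
rewrite /r exchange_rate// mul1r.
apply: (@le_trans _ _ (n i ^+ 2 + n j ^+ 2)); last first.
  by apply: (ler_term2_sum (F := fun k => n k ^+ 2)) => // k; exact: sqr_ge0.
have ni := negpart_mul (p i x); have nj := negpart_mul (p j x).
have := negpartNr (p i x); have := negpartNr (p j x).
have := negpart_ge0 (p i x); have := negpart_ge0 (p j x).
rewrite -/(n i) -/(n j) in ni nj *.
set x1 := n i in ni *; set x2 := n j in nj *; set p1 := p i x in ni *; set p2 := p j x in nj *.
move=> x20 x10 px2 px1.
have h1 : a * (x2 * - p1) <= a * (x2 * x1) by rewrite !ler_wpM2l.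
have h2 : b * (x1 * - p2) <= b * (x1 * x2) by rewrite !ler_wpM2l.
have h3 : a * (x1 * p1) <= 0 by rewrite ni mulr_ge0_le0// oppr_le0 sqr_ge0.
have h4 : b * (x2 * p2) <= 0 by rewrite nj mulr_ge0_le0// oppr_le0 sqr_ge0.
have h5 : a * (x2 * x1) + b * (x1 * x2) = x1 * x2.
  by rewrite [x2 * x1]mulrC -mulrDl ab1 mul1r.
have := sqr_ge0 (x1 - x2); have := sqr_ge0 (x1 + x2); lra.
Qed.

(** The weights are [c j] and [c i], normalized by their sum. For [c i = 0], when the sum may
    vanish, the weights 1 and 0 serve instead. *)
Lemma exchange_exists i j : i != j -> (forall k, 0 <= c k) ->
  exists a b, exchange v c f (v j - v i) (a *: f i - b *: f j) /\ a * c i = b * c j.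
Proof.
move=> ij c0; have [ci0|ci0] := eqVneq (c i) 0.
  exists 1, 0; rewrite ci0 mulr0 mul0r; split => //; exists i, j, 1, 0.
  by rewrite ci0 mulr0 mul0r addr0; split.
have cij : 0 < c i + c j by rewrite ltr_pwDl// lt_neqAle eq_sym ci0 c0.
have abc : c j / (c i + c j) * c i = c i / (c i + c j) * c j 
  by rewrite mulrAC [RHS]mulrAC [c j * c i]mulrC.
exists (c j / (c i + c j)), (c i / (c i + c j)); split => //.
exists i, j, (c j / (c i + c j)), (c i / (c i + c j)); split => //.
split; rewrite ?divr_ge0// ?(ltW cij)//.
by rewrite -mulrDl addrC divff// gt_eqF.
Qed.

(** Tracing the flow back along an edge direction reduces the problem to points where one of the
    coordinates [i], [j] vanishes and all others are unchanged. *)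
Lemma exchange_back (A : set 'M[R]_d) i j y :
  (forall k, 0 <= c k) -> (forall u phi, exchange v c f u phi -> A (u *m phi)) ->
  i != j -> polyhedron c f y ->
  (forall y', polyhedron c f y' -> (forall k, k != i -> k != j -> p k y' = p k y) ->
     p i y' = 0 \/ p j y' = 0 ->
     forall t, 0 <= t -> reach A (polyhedron c f) t y') ->
  forall t, 0 <= t -> reach A (polyhedron c f) t y.
Proof.
move=> c0 GA ij Py back.
have [a [b [G ab]]] := exchange_exists ij c0.
have [r0|r0] := eqVneq (lform (a *: f i - b *: f j) y) 0.
  by move=> t t0; exact: reach_stationary (GA _ _ G) Py r0.
set phi := a *: f i - b *: f j in r0 G.
pose r := lform phi y; rewrite -/r in r0.
(* Going back by [th] adds [th * r] to [p i] and subtracts it from [p j]; the sign of [r] decides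
   which of them decreases, and [th] brings that one to 0. *)
pose th := if 0 < r then p j y / r else - (p i y / r).
have th0 : 0 <= th.
  rewrite /th; case: ltP => [rp|rn]; first by rewrite divr_ge0 ?(ltW rp)//; exact: Py.
  by rewrite -mulrN mulr_ge0 ?oppr_ge0 ?invr_le0//; exact: Py.
have pk k : p k (y - (th * r) *: (v j - v i)) =
    p k y - (th * r) * ((k == j)%:R - (k == i)%:R).
  by rewrite -scaleNr slack_edge mulNr.
have pi : p i (y - (th * r) *: (v j - v i)) = p i y + th * r.
  by rewrite pk eqxx (negPf ij) sub0r mulrN1 opprK.
have pj : p j (y - (th * r) *: (v j - v i)) = p j y - th * r.
  by rewrite pk eqxx [j == i]eq_sym (negPf ij) subr0 mulr1.
have po k : k != i -> k != j -> p k (y - (th * r) *: (v j - v i)) = p k y.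
  by move=> /negPf ki /negPf kj; rewrite pk ki kj subrr mulr0 subr0.
have thr : (th * r = p j y) \/ (th * r = - p i y).
  by rewrite /th; case: ifP => _; [left|right]; rewrite ?mulNr divfK.
have Pi := Py i; have Pj := Py j.
have Py' : polyhedron c f (y - (th * r) *: (v j - v i)).
  move=> k; have [->|ki] := eqVneq k i; first by rewrite pi; case: thr => ->; lra.
  have [->|kj] := eqVneq k j; first by rewrite pj; case: thr => ->; lra.
  by rewrite po.
apply: (reach_flow (GA _ _ G) (exchange_eigen G) th0 Py Py').
apply: back => //; rewrite pi pj.
by case: thr => ->; [right|left]; rewrite subrr.
Qed.

(** There are at least three coordinates as [2 <= d]. A first exchange makes one of two vanish; the
    second pairs the other one with the third coordinate, leaving the zero untouched. With two zeros
    the exchange between them is at rest. *)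
Lemma exchange_back_all (A : set 'M[R]_d) (y : 'cV[R]_d) : (2 <= d)%N ->
  (forall k, 0 <= c k) -> (forall u phi, exchange v c f u phi -> A (u *m phi)) ->
  polyhedron c f y -> forall t, 0 <= t -> reach A (polyhedron c f) t y.
Proof.
move=> d2 c0 GA Py.
pose k0 : 'I_d.+1 := ord0.
pose k1 : 'I_d.+1 := Ordinal (leqW d2 : (1 < d.+1)%N).
pose k2 : 'I_d.+1 := Ordinal (d2 : (2 < d.+1)%N).
have two_zeros i j z : i != j -> polyhedron c f z -> p i z = 0 -> p j z = 0 ->
    forall t, 0 <= t -> reach A (polyhedron c f) t z.
  move=> ij Pz pi pj t t0; have [a [b [G ab]]] := exchange_exists ij c0.
  apply: reach_stationary (GA _ _ G) Pz _.
  by rewrite exchange_rate// pi pj !mulr0 subrr.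
apply: (exchange_back (i := k0) (j := k1)) => // z Pz _ [z0|z1].
- apply: (exchange_back (i := k1) (j := k2)) => // w Pw wz [w1|w2].
  + by apply: (@two_zeros k0 k1) => //; rewrite wz.
  + by apply: (@two_zeros k0 k2) => //; rewrite wz.
- apply: (exchange_back (i := k0) (j := k2)) => // w Pw wz [w0|w2].
  + by apply: (@two_zeros k1 k0) => //; rewrite wz.
  + by apply: (@two_zeros k1 k2) => //; rewrite wz.
Qed.

(** The coefficients [lform (f k) x] sum to 0, so [v i] may be subtracted from every [v k] in the
    expansion of [x]. *)
Lemma edges_span (V : {vspace 'cV[R]_d}) i :
  (forall k, v k - v i \in V) -> V = fullv.
Proof.
move=> vV; apply/vspaceP => x; rewrite memvf; apply/idP.
have -> : x = \sum_k lform (f k) x *: (v k - v i).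
  rewrite {1}(lform_expand x) -[LHS]subr0 -[X in _ - X](scale0r (v i)).
  rewrite -(sum_lform_eq0 x) scaler_suml -sumrB.
  by apply: eq_bigr => k _; rewrite scalerBr.
by apply: memv_suml => k _; exact: memvZ.
Qed.

Lemma lform_neq0_of_stable (V : {vspace 'cV[R]_d}) (u x : 'cV[R]_d) (phi : 'rV[R]_d) :
  (forall u phi, exchange v c f u phi -> forall y, y \in V -> lform phi y *: u \in V) ->
  exchange v c f u phi -> x \in V -> lform phi x != 0 -> u \in V.
Proof.
move=> stable G xV /negPf phix.
by have := stable _ _ G _ xV; rewrite rpredZeq phix.
Qed.

(** A nonzero [x] in [V] is moved by some exchange, which puts an edge [v j - v i] into [V]. The
    exchange of [i] with any other [k] moves that edge in turn, which yields all edges at [v i]. *)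
Lemma exchange_irreducible_interior (V : {vspace 'cV[R]_d}) :
  (forall k, 0 < c k) ->
  (forall u phi, exchange v c f u phi -> forall y, y \in V -> lform phi y *: u \in V) ->
  V != 0%VS -> V = fullv.
Proof.
move=> c0 stable V0; have c0' k : 0 <= c k by exact: ltW.
pose x := vpick V; have xV : x \in V by exact: memv_pick.
have x0 : x != 0 by rewrite vpick0.
have [i [j [ij fij]]] : exists i j, i != j /\ lform (f i) x * c j != lform (f j) x * c i.
  apply: contrapT => noij; move/eqP: x0; apply.
  (* If all exchanges fix [x], the values [lform (f k) x] are proportional to [c k]. They sum to 0
     whereas the [c k] sum to 1, so all of them vanish. *)
  have prop k : lform (f k) x = lform (f ord0) x / c ord0 * c k.
    have [->|k0] := eqVneq k ord0; first by rewrite divfK// gt_eqF.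
    apply: (mulIf (x := c ord0)); first by rewrite gt_eqF.
    rewrite mulrAC divfK ?gt_eqF//; apply/eqP; apply: contrapT => /negP ne.
    by apply: noij; exists k, ord0.
  have : lform (f ord0) x / c ord0 = 0.
    have := sum_lform_eq0 x; rewrite (eq_bigr _ (fun k _ => prop k)) -mulr_sumr.
    case: bar => _ s1 _; have := s1 0.
    rewrite (eq_bigr c) => [->|k _]; first by rewrite mulr1.
    by rewrite /slack lform0 addr0.
  move=> mu0; rewrite (lform_expand x) big1// => k _.
  by rewrite prop mu0 mul0r scale0r.
have exch k l : k != l -> exists a b, [/\ 0 < a, 0 < b, a * c k = b * c l &
    exchange v c f (v l - v k) (a *: f k - b *: f l)].
  move=> kl; exists (c l / (c k + c l)), (c k / (c k + c l)).
  have ckl : 0 < c k + c l by rewrite addr_gt0.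
  have ab : c l / (c k + c l) * c k = c k / (c k + c l) * c l.
    by rewrite mulrAC [RHS]mulrAC [c l * c k]mulrC.
  split; rewrite ?divr_gt0//.
  exists k, l, (c l / (c k + c l)), (c k / (c k + c l)); split=> //.
  by split; rewrite ?divr_ge0 ?(ltW ckl)// -mulrDl addrC divff// gt_eqF.
have vjV : v j - v i \in V.
  have [a [b [a0 b0 ab G]]] := exch i j ij.
  apply: (lform_neq0_of_stable stable G xV); apply: contra_neq fij.
  rewrite lformDl lformNl !lformZl => /subr0_eq fab.
  apply: (mulfI (x := a)); first by rewrite gt_eqF.
  by rewrite mulrA fab mulrCA ab [RHS]mulrCA mulrA.
apply: (@edges_span _ i) => k; have [->|ki] := eqVneq k i; first by rewrite subrr mem0v.
have [->//|kj] := eqVneq k j.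
have ik : i != k by rewrite eq_sym.
have [a [b [a0 b0 ab G]]] := exch i k ik.
apply: (lform_neq0_of_stable stable G vjV).
rewrite lformDl lformNl !lformZl !lform_edge eqxx (negPf ij) (negPf ki) (negPf kj).
by rewrite sub0r subrr mulr0 subr0 mulrN1 oppr_eq0 gt_eqF.
Qed.

(** Here [c] is the indicator of [i0], so for [i != i0] the weights 1 and 0 are admissible with
    every [k]. A single [i != i0] with [lform (f i) x != 0] then brings all edges at [v i] into
    [V]. *)
Lemma exchange_irreducible_vertex (V : {vspace 'cV[R]_d}) i0 : v i0 = 0 ->
  (forall u phi, exchange v c f u phi -> forall y, y \in V -> lform phi y *: u \in V) ->
  V != 0%VS -> V = fullv.
Proof.
move=> vi0 stable V0.
have cE k : c k = (k == i0)%:R.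
  by case: bar => sv _ _; rewrite -sv vi0 /slack lform0 addr0.
pose x := vpick V; have xV : x \in V by exact: memv_pick.
have x0 : x != 0 by rewrite vpick0.
have [i [ii0 fi]] : exists i, i != i0 /\ lform (f i) x != 0.
  apply: contrapT => noi; move/eqP: x0; apply.
  rewrite (lform_expand x) big1// => k _.
  have [->|ki0] := eqVneq k i0; first by rewrite vi0 scaler0.
  have [->|fk] := eqVneq (lform (f k) x) 0; first by rewrite scale0r.
  by case: noi; exists k.
apply: (@edges_span _ i) => k; have [->|ki] := eqVneq k i; first by rewrite subrr mem0v.
have G : exchange v c f (v k - v i) (1 *: f i - 0 *: f k).
  exists i, k, 1, 0; split => //; first by rewrite eq_sym.
  - by rewrite addr0.
  - by rewrite cE (negPf ii0) mulr0 mul0r.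
apply: (lform_neq0_of_stable stable G xV).
by rewrite scale1r scale0r subr0.
Qed.

End Exchange.

Theorem simplex_realizable (R : realType) (d : nat) (v : 'I_d.+1 -> 'cV[R]_d) :
  (2 <= d)%N -> affinely_independent v ->
  interior (simplex v) 0 \/ (exists i, v i = 0) -> realizable (simplex v).
Proof.
move=> d2 /barycentric_exists[c [f bar]].
rewrite (simplex_polyhedron bar) => int_or_vertex.
have [sv s1 sx] := bar.
have k01 : (ord0 : 'I_d.+1) != Ordinal (leqW d2 : (1 < d.+1)%N) by [].
set k1 := Ordinal _ in k01.
have c0 k : 0 <= c k.
  have -> : c k = slack (c k) (f k) 0 by rewrite /slack lform0 addr0.
  case: int_or_vertex => [/interior_subset|[i <-]]; first exact.
  by rewrite sv.
pose S := \sum_k `|v k|; pose F := \sum_k `|f k|.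
have vS k : `|v k| <= S by apply: (ler_term_sum (F := fun k => `|v k|)).
have fF k : `|f k| <= F by apply: (ler_term_sum (F := fun k => `|f k|)).
have S0 : 0 <= S by exact: sumr_ge0.
have F0 : 0 <= F by exact: sumr_ge0.
(* The summand 1 is the quasi-invariance constant, and the product bounds the norm of every
   [(v j - v i) *m phi]. *)
pose C := 1 + (S + S) * (F + F).
have C1 : 1 <= C by rewrite lerDl mulr_ge0 ?addr_ge0.
apply: (@polyhedron_realizable _ _ _ c f (exchange v c f) C) => //.
- exists S => x Px; rewrite (sx x); apply: le_trans (ler_norm_sum _ _ _) _.
  apply: ler_sum => k _; rewrite normrZ ger0_norm; last exact: Px.
  rewrite ler_piMl// -(s1 x).
  by apply: (ler_term_sum (F := fun k => slack (c k) (f k) x)).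
- have Pv k : polyhedron c f (v k) by move=> l; rewrite sv.
  have [v0|v0] := eqVneq (v ord0) 0; last by exists (v ord0).
  exists (v k1) => //; apply/eqP => v1.
  have := sv k1 ord0; rewrite v0 -v1 sv eqxx [k1 == _]eq_sym (negPf k01) => /eqP.
  by rewrite oner_eq0.
- move=> u phi G; split.
  + have [i [j [a [b [ij [a0 b0 ab1] ab uE phiE]]]]] := G.
    apply: le_trans (dyad_norm_le _ _) _.
    rewrite -[leLHS]add0r lerD// ler_pM//.
      by rewrite uE (le_trans (ler_normB _ _))// lerD.
    rewrite phiE (le_trans (ler_normB _ _))// !normrZ !ger0_norm// lerD//.
      by rewrite (le_trans _ (fF i))// ler_piMl//; lra.
    by rewrite (le_trans _ (fF j))// ler_piMl//; lra.
  + exact: exchange_eigen G.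
  + exact: quasi_invariant_le C1 (exchange_quasi_invariant bar G).
- move=> V; case: int_or_vertex => [int0|[i0 vi0]].
    apply: exchange_irreducible_interior => // k.
    have [l kl] : exists l, k != l.
      by have [->|k0] := eqVneq k ord0; [exists k1|exists ord0].
    apply: (interior_polyhedron int0 (w := v l - v k)).
    by rewrite (lform_edge bar) eqxx (negPf kl) sub0r ltrN10.
  exact: exchange_irreducible_vertex vi0.
- have [a [b [G _]]] := exchange_exists v f k01 c0.
  by exists (v k1 - v ord0), (a *: f ord0 - b *: f k1).
- by move=> A GA y Py; exact: exchange_back_all.
Qed.

(** * Parallelepipeds *)

(* Facets of the parallelepiped in the coordinates [x i = lform (phi i) x]:
   [(i, true)] is [- a i <= x i] and [(i, false)] is [x i <= 1 - a i]. *)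
Definition box_offset (R : realType) (d : nat) (a : 'I_d -> R) (k : 'I_d * bool) : R :=
  if k.2 then a k.1 else 1 - a k.1.

Definition box_normal (R : realType) (d : nat) (phi : 'I_d -> 'rV[R]_d)
    (k : 'I_d * bool) : 'rV[R]_d :=
  if k.2 then phi k.1 else - phi k.1.

(** This keeps the target [r * x j] of the pursuit below within the range of [x i] while [x j] is in
    its own range. *)
Definition maps_side (R : realType) (a b r : R) :=
  forall t, - b <= t -> t <= 1 - b -> - a <= r * t /\ r * t <= 1 - a.

(* [x i' = - (x i - r * x j)]: the coordinate [x i] is attracted by [r * x j]. *)
Definition pursuit (R : realType) (d : nat) (e : 'I_d -> 'cV[R]_d)
    (phi : 'I_d -> 'rV[R]_d) (a : 'I_d -> R) (u : 'cV[R]_d) (psi : 'rV[R]_d) :=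
  exists i j r, [/\ i != j, maps_side (a i) (a j) r, u = - e i &
    psi = phi i - r *: phi j].

(** An interval of length 1 is scaled by [r] into an interval of length 1. *)
Lemma maps_side_norm (R : realType) (a b r : R) :
  0 <= b -> b <= 1 -> maps_side a b r -> `|r| <= 1.
Proof.
move=> b0 b1 /[dup] /(_ (- b)) h1 /(_ (1 - b)) h2.
have [? ?] := h1 (lexx _) ltac:(lra); have [? ?] := h2 ltac:(lra) (lexx _).
rewrite ler_norml; apply/andP; split; lra.
Qed.

Lemma maps_side0 (R : realType) (a b : R) : 0 <= a -> a <= 1 -> maps_side a b 0.
Proof. by move=> a0 a1 t _ _; rewrite mul0r; lra. Qed.

(** The source side lies in [-1, 1], so [r] may be the distance from 0 to the nearer end of the
    target side. *)
Lemma maps_side_interior (R : realType) (a b : R) :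
  0 < a -> a < 1 -> 0 <= b -> b <= 1 -> exists2 r, r != 0 & maps_side a b r.
Proof.
move=> a0 a1 b0 b1; exists (Num.min a (1 - a)).
  by rewrite gt_eqF// lt_min a0 subr_gt0.
have : 0 < Num.min a (1 - a) by rewrite lt_min a0 subr_gt0.
have : Num.min a (1 - a) <= a by rewrite ge_min lexx.
have : Num.min a (1 - a) <= 1 - a by rewrite ge_min lexx orbT.
set r := Num.min _ _ => r1 r2 r0 t tb t1.
have : 0 <= r * (1 - t) by rewrite mulr_ge0 ?(ltW r0)//; lra.
have : 0 <= r * (1 + t) by rewrite mulr_ge0 ?(ltW r0)//; lra.
by split; lra.
Qed.

(** Each side is [0, 1] or [-1, 0]; equal sides are matched by [r = 1], opposite ones by
    [r = -1]. *)
Lemma maps_side_vertex (R : realType) (a b : bool) :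
  exists2 r : R, r != 0 & maps_side a%:R b%:R r.
Proof.
have [<-|ab] := eqVneq a b.
  by exists 1; rewrite ?oner_eq0// => t ? ?; rewrite mul1r.
exists (-1); first by rewrite oppr_eq0 oner_eq0.
by move=> t; move: ab; case: a; case: b => //= _ ? ?; split; lra.
Qed.

(* Both sides have length 1, so scaling an end of the longer half onto an end of
   the shorter half keeps the opposite end inside. *)
Lemma maps_side_endpoint (R : realType) (a b x y : R) :
  0 <= a -> a <= 1 -> 0 <= b -> b <= 1 ->
  x = - a \/ x = 1 - a -> y = - b \/ y = 1 - b -> y != 0 -> `|x| <= `|y| ->
  maps_side a b (x / y).
Proof.
move=> a0 a1 b0 b1 xa yb y0 xy t tb t1.
have q1 : `|x / y| <= 1 by rewrite normrM normfV ler_pdivrMr ?normr_gt0// mul1r.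
have qy : x / y * y = x by rewrite divfK.
move: q1; rewrite ler_norml => /andP[].
have q_eq0 : x = 0 -> x / y = 0 by move=> ->; rewrite mul0r.
set q := x / y in qy q_eq0 *.
have [q0|/ltW q0] := leP 0 q => h1 h2.
  have : 0 <= q * (t + b) by rewrite mulr_ge0//; lra.
  have : 0 <= q * (1 - b - t) by rewrite mulr_ge0//; lra.
  have : 0 <= q * b by rewrite mulr_ge0.
  have : 0 <= q * (1 - b) by rewrite mulr_ge0//; lra.
  case: xa => xE; case: yb => yE; rewrite xE yE in qy q_eq0 * => *.
  - by split; lra.
  (* The chosen ends have opposite signs while [q >= 0], which leaves only [x = 0]. *)
  - have -> : q = 0 by apply: q_eq0; lra.
    by rewrite mul0r; split; lra.
  - have -> : q = 0 by apply: q_eq0; lra.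
    by rewrite mul0r; split; lra.
  - by split; lra.
have : 0 <= (- q) * (t + b) by rewrite mulr_ge0//; lra.
have : 0 <= (- q) * (1 - b - t) by rewrite mulr_ge0//; lra.
have : 0 <= (- q) * b by rewrite mulr_ge0//; lra.
have : 0 <= (- q) * (1 - b) by rewrite mulr_ge0//; lra.
case: xa => xE; case: yb => yE; rewrite xE yE in qy q_eq0 * => *.
- have -> : q = 0 by apply: q_eq0; lra.
    by rewrite mul0r; split; lra.
- by split; lra.
- by split; lra.
- have -> : q = 0 by apply: q_eq0; lra.
    by rewrite mul0r; split; lra.
Qed.

(** Replacing [y] by its projection [y + q1 - q2] onto its side makes the left-hand side
    nonpositive, because the target is then inside. As [|r| <= 1], the replacement costs at most
    [(m1 + m2) * (q1 + q2)], which the four squares absorb. *)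
Lemma pursuit_rate_le (R : realType) (a b r x y : R) : 0 <= b -> b <= 1 ->
  maps_side a b r ->
  (negpart (a + x) - negpart (1 - a - x)) * (x - r * y) <=
  negpart (a + x) ^+ 2 + negpart (1 - a - x) ^+ 2 +
  (negpart (b + y) ^+ 2 + negpart (1 - b - y) ^+ 2).
Proof.
move=> b0 b1 /[dup] /(maps_side_norm b0 b1) r1 side.
have m1E := negpart_mul (a + x); have m2E := negpart_mul (1 - a - x).
have m10 := negpart_ge0 (a + x); have m20 := negpart_ge0 (1 - a - x).
have q10 := negpart_ge0 (b + y); have q20 := negpart_ge0 (1 - b - y).
have [rt1 rt2] : - a <= r * (y + negpart (b + y) - negpart (1 - b - y)) /\
    r * (y + negpart (b + y) - negpart (1 - b - y)) <= 1 - a.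
  apply: side; rewrite /negpart;
    by case: (leP 0 (- (b + y))) => ?; case: (leP 0 (- (1 - b - y))) => ?; lra.
move: rt1 rt2 m1E m2E m10 m20 q10 q20.
set m1 := negpart (a + x); set m2 := negpart (1 - a - x).
set q1 := negpart (b + y); set q2 := negpart (1 - b - y).
move=> rt1 rt2 m1E m2E m10 m20 q10 q20.
have h1 := mulr_ge0 m10 (_ : 0 <= r * (y + q1 - q2) + a).
have {}h1 := h1 ltac:(lra).
have h2 := mulr_ge0 m20 (_ : 0 <= 1 - a - r * (y + q1 - q2)).
have {}h2 := h2 ltac:(lra).
have h3 : (m1 - m2) * (r * (q1 - q2)) <= (m1 + m2) * (q1 + q2).
  apply: le_trans (ler_norm _) _; rewrite !normrM.
  apply: ler_pM; rewrite ?mulr_ge0//.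
    by rewrite ler_norml; apply/andP; split; lra.
  rewrite -[leRHS]mul1r ler_pM// ler_norml; apply/andP; split; lra.
have := sqr_ge0 m1; have := sqr_ge0 m2.
have := sqr_ge0 (m1 - m2); have := sqr_ge0 (q1 - q2).
have := sqr_ge0 (m1 + m2 - (q1 + q2)); lra.
Qed.

Section Pursuit.
Variables (R : realType) (d : nat) (e : 'I_d -> 'cV[R]_d) (phi : 'I_d -> 'rV[R]_d).
Variable a : 'I_d -> R.
Hypothesis phi_e : forall i j, lform (phi i) (e j) = (i == j)%:R.
Hypothesis phi_x : forall x, x = \sum_i lform (phi i) x *: e i.
Hypothesis a0 : forall i, 0 <= a i.
Hypothesis a1 : forall i, a i <= 1.

Local Notation box := (polyhedron (box_offset a) (box_normal phi)).

Lemma boxP x : box x <-> forall i, - a i <= lform (phi i) x /\ lform (phi i) x <= 1 - a i.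
Proof.
split=> [Px i|Px [i [|]]].
- have := Px (i, true); have := Px (i, false).
  by rewrite /slack /box_offset /box_normal /= lformNl; lra.
- by have := Px i; rewrite /slack /box_offset /box_normal /=; lra.
- by have := Px i; rewrite /slack /box_offset /box_normal /= lformNl; lra.
Qed.

Lemma sum_box (F : 'I_d * bool -> R) : \sum_k F k = \sum_i (F (i, true) + F (i, false)).
Proof.
transitivity (\sum_i \sum_b F (i, b)).
  by rewrite pair_bigA; apply: eq_bigr => -[].
by apply: eq_bigr => i _; rewrite big_bool.
Qed.

Lemma pursuit_eigen u psi : pursuit e phi a u psi -> lform psi u = -1.
Proof.
move=> [i [j [r [ij _ -> ->]]]].
rewrite lformN lformDl lformNl lformZl !phi_e eqxx eq_sym (negPf ij).
by rewrite mulr0 subr0.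
Qed.

Lemma pursuit_quasi_invariant u psi : pursuit e phi a u psi ->
  quasi_invariant (box_offset a) (box_normal phi) 1 (u *m psi).
Proof.
move=> [i [j [r [ij side -> ->]]]] x; rewrite mul_dyad mul1r.
set s := lform _ x.
have sE : s = lform (phi i) x - r * lform (phi j) x by rewrite /s lformDl lformNl lformZl.
rewrite /violation !sum_box.
rewrite (bigD1 i)//= big1 ?addr0 => [|k /negPf ki]; last first.
  by rewrite /box_normal/= !lformNl lformZ lformN phi_e ki oppr0 mulr0 !oppr0 !mulr0 addr0.
rewrite /slack /box_offset /box_normal /= !lformNl !lformZ !lformN phi_e eqxx.
rewrite [leLHS](_ : _ = (negpart (a i + lform (phi i) x) -
  negpart (1 - a i - lform (phi i) x)) * s); last by rewrite mulr1n; ring.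
apply: (@le_trans _ _ (
  (negpart (a i + lform (phi i) x) ^+ 2 + negpart (1 - a i - lform (phi i) x) ^+ 2) +
  (negpart (a j + lform (phi j) x) ^+ 2 + negpart (1 - a j - lform (phi j) x) ^+ 2))).
  by rewrite sE; exact: pursuit_rate_le.
pose F k := negpart (a k + lform (phi k) x) ^+ 2 + negpart (1 - a k - lform (phi k) x) ^+ 2.
apply: le_trans (ler_term2_sum (F := F) _ ij) _.
  by move=> k; rewrite addr_ge0 ?sqr_ge0.
by apply: ler_sum => k _; rewrite /F lformNl.
Qed.

(** The pursuit with [r = 0] contracts [x i] to 0. Traced backwards it drives a nonzero [x i] away
    from 0 up to an end of its side, so the end reached is nonzero and may serve as a denominator
    later. *)
Lemma push_to_side (A : set 'M[R]_d) i j y :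
  (forall u psi, pursuit e phi a u psi -> A (u *m psi)) -> i != j -> box y ->
  (forall y', box y' -> (forall k, k != i -> lform (phi k) y' = lform (phi k) y) ->
     lform (phi i) y' = - a i \/ lform (phi i) y' = 1 - a i ->
     lform (phi i) y' != 0 ->
     forall t, 0 <= t -> reach A box t y') ->
  forall t, 0 <= t -> reach A box t y.
Proof.
move=> GA ij Py back.
have G : pursuit e phi a (- e i) (phi i - 0 *: phi j).
  by exists i, j, 0; split => //; exact: maps_side0.
have psiE : lform (phi i - 0 *: phi j) y = lform (phi i) y by rewrite scale0r subr0.
have [r0|r0] := eqVneq (lform (phi i) y) 0.
  by move=> t t0; apply: reach_stationary (GA _ _ G) Py _; rewrite psiE.
pose r := lform (phi i) y; rewrite -/r in r0.
pose th := if 0 < r then (1 - a i - r) / r else (- a i - r) / r.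
have [lo up] := (boxP y).1 Py i; rewrite -/r in lo up.
have th0 : 0 <= th.
  rewrite /th; case: ltP => [rp|rn]; first by rewrite divr_ge0 ?(ltW rp)//; lra.
  by rewrite -mulrNN mulr_ge0 -?invrN ?oppr_ge0 ?invr_le0 ?invr_ge0 ?oppr_ge0//; lra.
have thr : (0 < r /\ th * r = 1 - a i - r) \/ (r < 0 /\ th * r = - a i - r).
  rewrite /th; case: ltP => [rp|rn]; [left|right]; rewrite divfK//; split => //.
  by rewrite lt_neqAle r0.
have yk k : lform (phi k) (y - (th * r) *: (- e i)) = lform (phi k) y + th * r * (k == i)%:R.
  by rewrite scalerN opprK lformD lformZ phi_e.
have Py' : box (y - (th * lform (phi i - 0 *: phi j) y) *: (- e i)).
  rewrite psiE; apply/boxP => k; rewrite yk.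
  have [->|ki] := eqVneq k i; last by rewrite mulr0 addr0; exact: ((boxP y).1 Py k).
  by rewrite mulr1 -/r; have := a0 i; have := a1 i; case: thr => -[_ ->]; lra.
apply: (reach_flow (GA _ _ G) (pursuit_eigen G) th0 Py Py').
apply: back => //; rewrite psiE.
- by move=> k /negPf ki; rewrite yk ki mulr0 addr0.
- by rewrite yk eqxx mulr1 -/r; case: thr => -[_ ->]; [right|left]; lra.
- rewrite yk eqxx mulr1 -/r; have [rp|rn] := ltP 0 r.
    by rewrite gt_eqF// ltr_pwDl// mulr_ge0 ?(ltW rp).
  have rn' : r < 0 by rewrite lt_neqAle r0.
  by rewrite lt_eqF// ltr_nwDl// mulr_ge0_le0.
Qed.

Lemma pursuit_back (A : set 'M[R]_d) (y : 'cV[R]_d) : (2 <= d)%N ->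
  (forall u psi, pursuit e phi a u psi -> A (u *m psi)) ->
  box y -> forall t, 0 <= t -> reach A box t y.
Proof.
move=> d2 GA Py.
pose i : 'I_d := Ordinal (ltnW d2); pose j : 'I_d := Ordinal d2.
have ij : i != j by [].
have ji : j != i by [].
apply: (push_to_side GA ij Py) => z Pz _ zi zi0.
apply: (push_to_side GA ji Pz) => w Pw wz wj wj0 t t0.
have wi : lform (phi i) w = lform (phi i) z by rewrite wz.
rewrite -wi in zi zi0.
(* With both coordinates at ends, the quotient of the smaller by the larger in absolute value is an
   admissible [r], and this pursuit is at rest in [w]. *)
have stat k l : k != l -> lform (phi k) w = - a k \/ lform (phi k) w = 1 - a k ->
    lform (phi l) w = - a l \/ lform (phi l) w = 1 - a l -> lform (phi l) w != 0 ->
    `|lform (phi k) w| <= `|lform (phi l) w| -> reach A box t w.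
  move=> kl wk wl wl0 le_kl.
  have G : pursuit e phi a (- e k)
      (phi k - (lform (phi k) w / lform (phi l) w) *: phi l).
    by exists k, l, (lform (phi k) w / lform (phi l) w); split => //;
      exact: maps_side_endpoint.
  apply: reach_stationary (GA _ _ G) Pw _.
  by rewrite lformDl lformNl lformZl divfK// subrr.
have [le_ij|/ltW le_ji] := leP `|lform (phi i) w| `|lform (phi j) w|.
  exact: (@stat i j).
exact: (@stat j i).
Qed.

(** A vector of [V] with [x i != 0] yields [e i] through the pursuit with [r = 0]. Every other [e k]
    follows from a pursuit of [x i] by [x k] with nonzero [r], applied to [e i]. *)
Lemma pursuit_irreducible (V : {vspace 'cV[R]_d}) : (2 <= d)%N ->
  (forall i j, i != j -> exists2 r, r != 0 & maps_side (a i) (a j) r) ->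
  (forall u psi, pursuit e phi a u psi -> forall y, y \in V -> lform psi y *: u \in V) ->
  V != 0%VS -> V = fullv.
Proof.
move=> d2 coupled stable V0.
pose x := vpick V; have xV : x \in V by exact: memv_pick.
have x0 : x != 0 by rewrite vpick0.
have [i xi] : exists i, lform (phi i) x != 0.
  apply: contrapT => noi; move/eqP: x0; apply.
  rewrite (phi_x x) big1// => k _.
  have [->|fk] := eqVneq (lform (phi k) x) 0; first by rewrite scale0r.
  by case: noi; exists k.
have [j ij] : exists j, i != j.
  have [->|] := eqVneq i (Ordinal d2); last by exists (Ordinal d2).
  by exists (Ordinal (ltnW d2)).
have memN y : - y \in V -> y \in V by rewrite memvN.
have eiV : e i \in V.
  have G : pursuit e phi a (- e i) (phi i - 0 *: phi j).
    by exists i, j, 0; split => //; exact: maps_side0.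
  have := stable _ _ G _ xV; rewrite rpredZeq scale0r subr0 (negPf xi) /=.
  exact: memN.
apply/vspaceP => y; rewrite memvf (phi_x y); apply: memv_suml => k _; apply: memvZ.
have [->//|ki] := eqVneq k i.
have [r r0 side] := coupled k i ki.
have G : pursuit e phi a (- e k) (phi k - r *: phi i) by exists k, i, r.
have := stable _ _ G _ eiV; rewrite rpredZeq lformDl lformNl lformZl !phi_e eqxx.
by rewrite (negPf ki) sub0r mulr1 oppr_eq0 (negPf r0) /=; exact: memN.
Qed.

End Pursuit.

Lemma parallelepiped_polyhedron (R : realType) (d : nat) (p : 'cV[R]_d)
    (e : 'I_d -> 'cV[R]_d) (phi : 'I_d -> 'rV[R]_d) :
  (forall i j, lform (phi i) (e j) = (i == j)%:R) ->
  (forall x, x = \sum_i lform (phi i) x *: e i) ->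
  parallelepiped p e = polyhedron (box_offset (fun i => - lform (phi i) p)) (box_normal phi).
Proof.
move=> phi_e phi_x; apply/seteqP; split=> [_ [s s01 <-]|x /boxP Px].
  apply/boxP => i; rewrite lformD lform_sum.
  have -> : \sum_j lform (phi i) (s j *: e j) = s i.
    rewrite -[RHS](sum_mul_delta s); apply: eq_bigr => j _.
    by rewrite lformZ phi_e eq_sym.
  by have [? ?] := s01 i; lra.
exists (fun i => lform (phi i) (x - p)); last by rewrite -phi_x addrC subrK.
by move=> i; rewrite lformB; have [? ?] := Px i; lra.
Qed.

Theorem parallelepiped_realizable (R : realType) (d : nat) (p : 'cV[R]_d)
    (e : 'I_d -> 'cV[R]_d) :
  (2 <= d)%N -> free [tuple e i | i < d] ->
  interior (parallelepiped p e) 0 \/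
    (exists I : {set 'I_d}, parallelepiped_vertex p e I = 0) ->
  realizable (parallelepiped p e).
Proof.
move=> d2 /dual_basis[phi [phi_e phi_x]].
rewrite (parallelepiped_polyhedron p phi_e phi_x).
set a := fun i => - lform (phi i) p => int_or_vertex.
(* If the origin is the vertex given by [I], then [p] is minus the sum of the [e i] with [i] in
   [I]. *)
have aI (I : {set 'I_d}) : parallelepiped_vertex p e I = 0 -> forall i, a i = (i \in I)%:R.
  rewrite /parallelepiped_vertex => pI i.
  have : lform (phi i) (p + \sum_(j in I) e j) = 0 by rewrite pI lform0.
  rewrite lformD big_mkcond lform_sum /a => /eqP; rewrite addrC addr_eq0 => /eqP <-.
  rewrite -[RHS](sum_mul_delta (fun j => (j \in I)%:R)); apply: eq_bigr => j _.
  case: ifP => _; last by rewrite lform0 mul0r.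
  by rewrite phi_e eq_sym mul1r.
have a01 i : 0 <= a i /\ a i <= 1.
  case: int_or_vertex => [/interior_subset/boxP/(_ i)|[I /aI ->]].
    by rewrite lform0; lra.
  by case: (i \in I).
have a0 i : 0 <= a i by have [] := a01 i.
have a1 i : a i <= 1 by have [] := a01 i.
pose i0 : 'I_d := Ordinal d2; pose i1 : 'I_d := Ordinal (ltnW d2).
have i01 : i0 != i1 by [].
pose S := \sum_i `|e i|; pose F := \sum_i `|phi i|.
have eS i : `|e i| <= S by apply: (ler_term_sum (F := fun i => `|e i|)).
have phiF i : `|phi i| <= F by apply: (ler_term_sum (F := fun i => `|phi i|)).
have S0 : 0 <= S by exact: sumr_ge0.
have F0 : 0 <= F by exact: sumr_ge0.
pose C := 1 + S * (F + F).
have C1 : 1 <= C by rewrite lerDl mulr_ge0 ?addr_ge0.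
apply: (@polyhedron_realizable _ _ _ _ _ (pursuit e phi a) C) => //.
- exists S => x /boxP Px; rewrite (phi_x x); apply: le_trans (ler_norm_sum _ _ _) _.
  apply: ler_sum => i _; rewrite normrZ ler_piMl//.
  have := Px i; have := a0 i; have := a1 i.
  by rewrite ler_norml => ? ? [? ?]; apply/andP; split; lra.
(* A nonzero point of the box: a multiple of [e i0] at an end of its side, one of the two ends being
   nonzero. *)
- have end_in r : r != 0 -> r = - a i0 \/ r = 1 - a i0 ->
      exists2 x, polyhedron (box_offset a) (box_normal phi) x & x != 0.
    move=> r0 rE; exists (r *: e i0).
      apply/boxP => i; rewrite lformZ phi_e; have := a0 i; have := a1 i.
      have [->|_] := eqVneq i i0; last by rewrite mulr0; lra.
      by rewrite mulr1; case: rE => ->; lra.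
    apply/eqP => re0; have := congr1 (lform (phi i0)) re0.
    by rewrite lformZ phi_e eqxx mulr1 lform0; apply/eqP.
  have [ai0|ai0] := eqVneq (a i0) 0.
    by apply: (end_in (1 - a i0)); [rewrite ai0 subr0 oner_eq0|right].
  by apply: (end_in (- a i0)); [rewrite oppr_eq0|left].
- move=> u psi G; split.
  + have [i [j [r [ij /(maps_side_norm (a0 j) (a1 j)) r1 uE psiE]]]] := G.
    apply: le_trans (dyad_norm_le _ _) _.
    rewrite -[leLHS]add0r lerD// ler_pM//; first by rewrite uE normrN.
    rewrite psiE (le_trans (ler_normB _ _))// normrZ lerD//.
    by rewrite (le_trans _ (phiF j))// ler_piMl.
  + exact: pursuit_eigen G.
  + exact: quasi_invariant_le C1 (pursuit_quasi_invariant phi_e a0 a1 G).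
- move=> V; apply: pursuit_irreducible => // i j ij.
  case: int_or_vertex => [int0|[I /aI aE]]; last by rewrite !aE; exact: maps_side_vertex.
  apply: maps_side_interior => //.
    apply: (interior_polyhedron (k := (i, true)) (w := - e i) int0).
    by rewrite /box_normal /= lformN phi_e eqxx ltrN10.
  rewrite -subr_gt0; apply: (interior_polyhedron (k := (i, false)) (w := e i) int0).
  by rewrite /box_normal /= lformNl phi_e eqxx ltrN10.
- exists (- e i0), (phi i0 - 0 *: phi i1), i0, i1, 0; split => //.
  exact: maps_side0.
- by move=> A GA y Py; exact: (pursuit_back phi_e a0 a1).
Qed.

Theorem theorem9 (R : realType) (d : nat) (hd : (2 <= d)%N) :
  (forall v : 'I_d.+1 -> 'cV[R]_d,
     affinely_independent v ->
     interior (simplex v) 0 \/ (exists i, v i = 0) ->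
     realizable (simplex v)) /\
  (forall (p : 'cV[R]_d) (e : 'I_d -> 'cV[R]_d),
     free [tuple e i | i < d] ->
     interior (parallelepiped p e) 0 \/
       (exists I : {set 'I_d}, parallelepiped_vertex p e I = 0) ->
     realizable (parallelepiped p e)).
Proof.
split=> [v|p e]; first exact: simplex_realizable.
exact: parallelepiped_realizable.
Qed.
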